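(* Let $G=(V,E)$ be a finite simple graph with $V=\{1,\dots,n\}$ and $1$-Laplacian $\Delta_1$. A number $\lambda\in\mathbb R$ is a homological eigenvalue of $\Delta_1$ if and only if the subcomplex of $K_n$ induced by the vertices located in the open sublevel set $\{x\in|K_n|:F_1(x)<\lambda\}$ and the subcomplex of $K_n$ induced by the vertices located in the closed sublevel set $\{x\in|K_n|:F_1(x)\le\lambda\}$ have different homology groups. In particular, if there exists $\varnothing\ne A\subset V$ such that (1) $F_1(\mathbf 1_A)=\lambda$, and $F_1(v)\ne\lambda$ for any vertex $v$ of $K_n$ located in $\mathrm{link}(\mathbf 1_A)$, and (2) the subcomplex of $K_n$ induced by the vertices located in the open sublevel set $\{x\in\mathrm{link}(\mathbf 1_A):F_1(x)<\lambda\}$ is homologically non-trivial (has non-vanishing reduced homology), then $\lambda$ is a homological eigenvalue of $\Delta_1$.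
   Context: Every vertex of $G$ has degree $\deg(i)\ge1$. For $x\in\mathbb R^n\setminus\{0\}$, $F_1(x)=\dfrac{\sum_{\{i,j\}\in E}|x_i-x_j|}{\sum_{i\in V}\deg(i)|x_i|}$. $\mathbf 1_A\in\mathbb R^n$ is the characteristic vector of $A\subset V$. A real $c$ is a homological regular value of a real function $F$ if there is $\epsilon>0$ such that for all $t_1<t_2$ in $(c-\epsilon,c+\epsilon)$ the inclusion $\{F\le t_1\}\hookrightarrow\{F\le t_2\}$ induces isomorphisms on all homology groups; otherwise $c$ is a homological critical value. A homological eigenvalue of $\Delta_1$ is a homological critical value of $F_1$ (where $\{F_1\le t\}$ denotes $\{x\in\mathbb R^n:\|x\|_\infty=1,F_1(x)\le t\}$). $K_n$ is the simplicial complex with vertex set $\{-1,0,1\}^n\setminus\{0\}=\{\mathbf 1_A-\mathbf 1_B: A,B\subset V, A\cap B=\varnothing, A\cup B\neq\varnothing\}$, whose $n!\cdot 2^n$ maximal simplices are $\mathrm{conv}\{\mathbf 1_{A_i}-\mathbf 1_{B_i}:i=1,\dots,n\}$ with $A_1\subset\cdots\subset A_n$, $B_1\subset\cdots\subset B_n$, $A_n\cap B_n=\varnothing$ and $A_i\cup B_i\ne A_{i+1}\cup B_{i+1}$ for $i=1,\dots,n-1$. Equivalently, it is the order complex of the poset of pairs $(A,B)$ of disjoint subsets of $V$, not both empty, ordered by $(A,B)\prec(A',B')$ iff $A\subset A'$ and $B\subset B'$. Its geometric realization $|K_n|$ is identified with $\{x\in\mathbb R^n:\|x\|_\infty=1\}$.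 The subcomplex induced by a set of vertices consists of all simplices of $K_n$ all of whose vertices are in the set. For a vertex $v$, $\mathrm{star}(v)$ is the closure of the union of the simplices of $|K_n|$ having $v$ as a vertex, $\mathrm{star}^o(v)$ is the union of the relatively open simplices having $v$ as a vertex, and $\mathrm{link}(v)=\mathrm{star}(v)\setminus\mathrm{star}^o(v)$. *)

(* Defs.v *)
From HB Require Import structures.
From mathcomp Require Import all_boot all_order all_algebra.
From mathcomp Require Import freeg.
From mathcomp Require Import boolp classical_sets reals topology normedtype.

Set Implicit Arguments.
Unset Strict Implicit.
Unset Printing Implicit Defensive.

Import Order.TTheory GRing.Theory Num.Theory.
Import numFieldNormedType.Exports.

Local Open Scope classical_set_scope.
Local Open Scope ring_scope.

(* Singular and simplicial homology are both instances of the homology of a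
   semi-simplicial set [S]; subspaces and subcomplexes are families
   [P k : set (S k)] of its simplices that are closed under faces. *)
Record semisimplicial := Semisimplicial {
  simp :> nat -> choiceType;
  face : forall k, 'I_k.+2 -> simp k.+1 -> simp k }.

Section Homology.
Variables (C : comNzRingType) (S : semisimplicial).

Definition chain (k : nat) := {freeg (S k) / C}.

Definition bd (k : nat) : chain k.+1 -> chain k :=
  fglift (fun s => \sum_(i < k.+2) (-1) ^+ i *: << face i s >>).

Definition augmentation : chain 0 -> C := fglift (fun=> (1 : C^o)).

Implicit Types P Q : forall k, set (S k).

Definition chains_in P (k : nat) : set (chain k) :=
  [set c | forall s, s \in dom c -> P k s].
Arguments chains_in P k : clear implicits.

Definition cycles P (k : nat) : set (chain k) :=
  match k return set (chain k) with
  | 0 => chains_in P 0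
  | j.+1 => chains_in P j.+1 `&` [set c | bd c = 0]
  end.
Arguments cycles P k : clear implicits.

Definition boundaries P (k : nat) : set (chain k) :=
  @bd k @` chains_in P k.+1.
Arguments boundaries P k : clear implicits.

(* For P included in Q: the map from cycles P k / boundaries P k to
   cycles Q k / boundaries Q k induced by the inclusion is injective and
   surjective. Nested families have "different homology groups" when this
   fails in some degree. *)
Definition incl_homology_iso P Q (k : nat) : Prop :=
  (forall z, cycles P k z -> boundaries Q k z -> boundaries P k z) /\
  (forall z, cycles Q k z ->
     exists2 z', cycles P k z' & boundaries Q k (z - z')).

Definition reduced_cycles P (k : nat) : set (chain k) :=
  match k return set (chain k) with
  | 0 => chains_in P 0 `&` [set c | augmentation c = 0]
  | j.+1 => cycles P j.+1
  end.
Arguments reduced_cycles P k : clear implicits.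

(* The first disjunct is the non-vanishing of reduced homology in degree -1,
   which happens exactly when P is empty. *)
Definition reduced_homology_nontrivial P : Prop :=
  (exists a : C, ~ (augmentation @` chains_in P 0) a) \/
  (exists k, exists2 z, reduced_cycles P k z & ~ boundaries P k z).

End Homology.

Section Singular.
Variable R : realType.

Definition stdsimplex (k : nat) : set 'rV[R]_k.+1 :=
  [set t | (forall i, 0 <= t 0 i) /\ \sum_i t 0 i = 1].

Arguments stdsimplex k : clear implicits.

Definition coface_mx (k : nat) (i : 'I_k.+2) (t : 'rV[R]_k.+1) : 'rV[R]_k.+2 :=
  \row_j (if unlift i j is Some j' then t 0 j' else 0).

Lemma coface_subproof (k : nat) (i : 'I_k.+2) (t : stdsimplex k) :
  coface_mx i (val t) \in stdsimplex k.+1.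
Proof.
case: t => t /=; rewrite !inE => -[t_ge0 t_sum]; split.
  by move=> j; rewrite mxE; case: unlift.
rewrite (bigD1_ord i) //= mxE unlift_none add0r -[RHS]t_sum.
by apply: eq_bigr => j _; rewrite mxE liftK.
Qed.

Definition coface (k : nat) (i : 'I_k.+2) (t : stdsimplex k) :
  stdsimplex k.+1 := exist _ (coface_mx i (val t)) (coface_subproof i t).

Definition singular (T : topologicalType) : semisimplicial :=
  @Semisimplicial (fun k => (stdsimplex k -> T) : choiceType)
    (fun k i s => s \o coface i).

(* A singular simplex of the subspace X is a continuous map into the ambient
   space with image in X. *)
Definition singular_in (T : topologicalType) (X : set T) (k : nat) :
  set (singular T k) := [set s | continuous s /\ range s `<=` X].

Definition homological_regular_value (C : comNzRingType) (T : topologicalType)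
    (D : set T) (F : T -> R) (c : R) : Prop :=
  exists2 eps : R, 0 < eps &
    forall t1 t2 : R, c - eps < t1 -> t1 < t2 -> t2 < c + eps ->
    forall k : nat,
      incl_homology_iso C (singular_in (D `&` [set x | F x <= t1]))
                          (singular_in (D `&` [set x | F x <= t2])) k.

Definition homological_critical_value (C : comNzRingType)
    (T : topologicalType) (D : set T) (F : T -> R) (c : R) : Prop :=
  ~ homological_regular_value C D F c.

End Singular.

Section OneLaplacian.
Variables (R : realType) (n : nat) (e : rel 'I_n).

Definition degree (i : 'I_n) : nat := #|[pred j | e i j]|.

Definition F1 (x : 'rV[R]_n) : R :=
  (\sum_(i < n) \sum_(j < n | (i < j)%N && e i j) `|x 0 i - x 0 j|) /
  (\sum_(i < n) (degree i)%:R * `|x 0 i|).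

(* The norm of 'rV[R]_n is the sup norm. *)
Definition unit_sphere : set 'rV[R]_n := [set x | `|x| = 1].

Definition homological_eigenvalue (C : comNzRingType) (lambda : R) : Prop :=
  homological_critical_value C unit_sphere F1 lambda.

End OneLaplacian.

Section Kn.
Variables (R : realType) (n : nat).

(* The pair (A, B) of disjoint sets encodes the vertex 1_A - 1_B. *)
Definition setpair : finType := ({set 'I_n} * {set 'I_n})%type.

Definition Kn_vertex (v : setpair) : bool :=
  [disjoint v.1 & v.2] && (v.1 :|: v.2 != finset.set0).

Definition vec (v : setpair) : 'rV[R]_n :=
  \row_i ((i \in v.1)%:R - (i \in v.2)%:R).

Definition slt (v w : setpair) : bool :=
  [&& v.1 \subset w.1, v.2 \subset w.2 & v != w].

(* [slt] is transitive, so a sorted tuple is a chain; listing every simplex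
   of this order complex in increasing order also orients it. *)
Definition Kn_simplex (k : nat) (s : k.+1.-tuple setpair) : bool :=
  all Kn_vertex s && sorted slt s.

Definition setpair_tuples : semisimplicial :=
  @Semisimplicial (fun k => k.+1.-tuple setpair)
    (fun k i s => [tuple tnth s (fintype.lift i j) | j < k.+1]).

Definition induced_subcomplex (X : set 'rV[R]_n) (k : nat) :
  set (setpair_tuples k) :=
  [set s | Kn_simplex s /\ forall v, v \in (s : seq setpair) -> X (vec v)].

Definition closed_simplex (k : nat) (s : k.+1.-tuple setpair) :
  set 'rV[R]_n :=
  [set x | exists w : 'I_k.+1 -> R,
     [/\ forall i, 0 <= w i, \sum_i w i = 1
       & x = \sum_i w i *: vec (tnth s i)]].

Definition open_simplex (k : nat) (s : k.+1.-tuple setpair) :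
  set 'rV[R]_n :=
  [set x | exists w : 'I_k.+1 -> R,
     [/\ forall i, 0 < w i, \sum_i w i = 1
       & x = \sum_i w i *: vec (tnth s i)]].

Definition star (v : setpair) : set 'rV[R]_n :=
  closure [set x | exists k (s : k.+1.-tuple setpair),
             [/\ Kn_simplex s, v \in s & closed_simplex s x]].

Definition open_star (v : setpair) : set 'rV[R]_n :=
  [set x | exists k (s : k.+1.-tuple setpair),
             [/\ Kn_simplex s, v \in s & open_simplex s x]].

Definition link (v : setpair) : set 'rV[R]_n := star v `\` open_star v.

End Kn.

Arguments unit_sphere : clear implicits.
Arguments induced_subcomplex {R n} X k.
Arguments vec R {n} v.
Arguments link R {n} v.

(* Main.v *)
Require Import Defs.
From HB Require Import structures.
From mathcomp Require Import all_boot all_order all_algebra.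
From mathcomp Require Import freeg.
From mathcomp Require Import boolp classical_sets functions reals topology normedtype sequences.
From mathcomp Require Import lra ring.

Set Implicit Arguments.
Unset Strict Implicit.
Unset Printing Implicit Defensive.

Import Order.TTheory GRing.Theory Num.Theory.
Import numFieldNormedType.Exports.

Local Open Scope classical_set_scope.
Local Open Scope ring_scope.

(* On every simplex of K_n both the numerator and the denominator of F_1 are
   linear, so {F_1 <= t} behaves like the subcomplex L_t induced by its vertices.
   A point x of the sphere lies in the simplex of the level sets
   ({x_i >= th}, {x_i <= -th}), th > 0; peeling off levels one at a time shows that
   each x with F_1 x <= t has a level in L_t around which the coordinates of x
   leave a gap bounded below uniformly in x.  Choosing such a vertex f(x) for each
   x, the vertices chosen at points close to y are all levels of y, so they span a
   simplex of L_t and the straight segments towards it stay in {F_1 <= t}.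
   Subdividing a singular chain until its simplices are small and replacing them
   by affine simplices on the chosen vertices therefore inverts, up to homotopy,
   the map from simplicial chains of L_t to singular chains of {F_1 <= t}.
   Hence sublevel inclusions can be tested on induced subcomplexes, which change
   only at the finitely many values of F_1 at vertices.

   For the second claim, a reduced cycle z of the link of v = 1_A is the boundary
   of the cone v z.  If both inclusion maps were isomorphisms, z = dw below the
   level, and v z - w is homologous to a cycle below the level; the v-component of
   that homology lies in the link, since no neighbour of v has value lambda, and
   it fills z there. *)

(** Both kinds of chains are moved to free modules on lists [seq V]: all degrees share one module,
    the empty list carries the augmentation, and coning is adding a head. Every homotopy needed
    (subdivision to identity, straight line, sorting, round trip from simplicial chains) is then an
    instance of one cone recursion, [homot], and its values are located by carrier lemmas.
    Operations on singular chains are defined on the standard simplices and transported along [s] by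
    naturality in the faces. Two obstacles shape the comparison. The choice [f] is not continuous,
    so the width of the gap must not depend on the point: a single [c] tells how fine a chain has to
    be before the vertices at its corners span a simplex. And those vertices come in arbitrary order
    with repetitions, while simplices of K_n are strictly increasing tuples; the signed sorting
    [sortc] bridges this, being a chain map homotopic to the identity on lists of comparable
    vertices. *)

Section FreeModules.
Variable C : comNzRingType.
Implicit Types (K L : choiceType) (M : lmodType C).

Lemma fglift_is_linear K M (f : K -> M) : linear (fglift f).
Proof.
move=> a c c'.
have add : {morph fglift f : x y / x + y}.
  move=> x y; have B := lift_is_additive f.
  have B0 : fglift f 0 = 0 by have := B 0 0; rewrite !subrr.
  by have := B x (- y); have := B 0 y; rewrite opprK !sub0r B0 sub0r => ->; rewrite opprK.
have B0 : fglift f 0 = 0 by have := add 0 0; rewrite addr0 => /eqP;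
  rewrite -subr_eq0 opprD addNKr oppr_eq0 => /eqP.
rewrite add; congr (_ + _).
have sc x k : a *: << k *g x >> = << a * k *g x >> :> {freeg K / C}.
  by apply/eqP/freeg_eqP => y; rewrite coeffZ !coeffU mulrA.
rewrite -[c]freeg_sumE scaler_sumr !(big_morph (fglift f) add B0) scaler_sumr.
by apply: eq_bigr => x _; rewrite sc !liftU scalerA.
Qed.

Fact flift_key K M (f : K -> M) :
  {l : {linear {freeg K / C} -> M} | forall c, fglift f c = l c}.
Proof.
pose l := HB.pack_for {linear {freeg K / C} -> M} (fglift f)
  (GRing.isLinear.Build C {freeg K / C} M _ (fglift f) (fglift_is_linear f)).
by exists l.
Qed.

(* Opaque, so that simplification does not unfold linear maps to [fglift]. *)
Definition flift K M (f : K -> M) : {linear {freeg K / C} -> M} :=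
  sval (flift_key f).

Lemma fliftE K M (f : K -> M) c : fglift f c = flift f c.
Proof. exact: (svalP (flift_key f)). Qed.

Lemma fliftU K M (f : K -> M) x : flift f << x >> = f x.
Proof. by rewrite -fliftE liftU scale1r. Qed.

Lemma freegZU K (a : C) (x : K) : << a *g x >> = a *: << x >> :> {freeg K / C}.
Proof. by apply/eqP/freeg_eqP => y; rewrite coeffZ !coeffU mul1r. Qed.

Lemma freeg_decomp K (c : {freeg K / C}) :
  c = \sum_(x <- dom c) coeff x c *: << x >>.
Proof. by rewrite -{1}[c]freeg_sumE; apply: eq_bigr => x _; rewrite freegZU. Qed.

Definition carried K (P : set K) (c : {freeg K / C}) : Prop :=
  forall x, x \in dom c -> P x.

Lemma linear_ext_in K M (P : set K) (f g : {linear {freeg K / C} -> M}) :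
  (forall x, P x -> f << x >> = g << x >>) -> forall c, carried P c -> f c = g c.
Proof.
move=> fg c Pc; rewrite [c]freeg_decomp !linear_sum /=.
by apply: eq_big_seq => x /Pc/fg e; rewrite !linearZ e.
Qed.

Lemma linear_ext K M (f g : {linear {freeg K / C} -> M}) :
  (forall x, f << x >> = g << x >>) -> f =1 g.
Proof. by move=> fg c; apply: (@linear_ext_in K M setT). Qed.

Lemma carried0 K (P : set K) : carried P 0.
Proof. by move=> x; rewrite dom0. Qed.

Lemma carriedD K (P : set K) c c' : carried P c -> carried P c' -> carried P (c + c').
Proof. by move=> Pc Pc' x /domD_subset; rewrite mem_cat => /orP[/Pc|/Pc']. Qed.

Lemma carriedZ K (P : set K) a c : carried P c -> carried P (a *: c).
Proof. by move=> Pc x /domZ_subset/Pc. Qed.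

Lemma carriedN K (P : set K) c : carried P c -> carried P (- c).
Proof. by move=> Pc x; rewrite domN => /Pc. Qed.

Lemma carriedB K (P : set K) c c' : carried P c -> carried P c' -> carried P (c - c').
Proof. by move=> Pc Pc'; apply: carriedD => //; apply: carriedN. Qed.

Lemma carried_sum K (P : set K) (I : eqType) (r : seq I) (F : I -> {freeg K / C}) :
  (forall i, i \in r -> carried P (F i)) -> carried P (\sum_(i <- r) F i).
Proof.
move=> PF; rewrite big_seq; apply: big_ind => //; first exact: carried0.
exact: carriedD.
Qed.

Lemma carriedU K (P : set K) x : P x -> carried P << x >>.
Proof. by move=> Px y; rewrite domU1 inE => /eqP->. Qed.

Lemma carriedW K (P Q : set K) c : (forall x, P x -> Q x) -> carried P c -> carried Q c.
Proof. by move=> PQ Pc x /Pc/PQ. Qed.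

Lemma carriedI K (P Q : set K) c : carried P c -> carried Q c -> carried (fun x => P x /\ Q x) c.
Proof. by move=> Pc Qc x xc; split; [exact: Pc|exact: Qc]. Qed.

Lemma carried_lin K L (P : set K) (Q : set L) (f : {linear {freeg K / C} -> {freeg L / C}}) c :
  (forall x, P x -> carried Q (f << x >>)) -> carried P c -> carried Q (f c).
Proof.
move=> Pf Pc; rewrite [c]freeg_decomp linear_sum; apply: carried_sum => x /Pc Px.
by rewrite linearZ; apply: carriedZ; apply: Pf.
Qed.

End FreeModules.

(** * Chains on lists: cones, augmented boundary and chain homotopies *)

Section SeqChains.
Variable C : comNzRingType.
Implicit Types V W U : choiceType.

Local Notation chn V := {freeg (seq V) / C}.

Definition cone V (x : V) : {linear chn V -> chn V} := flift (fun s => << x :: s >>).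

(* The empty sequence spans degree [-1], so that this boundary is augmented and
   [del (cone x c) = c - cone x (del c)] holds in all degrees. *)
Fixpoint dS V (s : seq V) : chn V :=
  if s is x :: s' then << s' >> - cone x (dS s') else 0.

Definition del V : {linear chn V -> chn V} := flift (@dS V).

Lemma coneU V (x : V) s : cone x << s >> = << x :: s >>.
Proof. exact: fliftU. Qed.

Lemma delU V (s : seq V) : del V << s >> = dS s.
Proof. exact: fliftU. Qed.

Lemma del_cone V (x : V) c : del V (cone x c) = c - cone x (del V c).
Proof.
apply: (@linear_ext C (seq V) _ (del V \o cone x) (idfun \- (cone x \o del V))) => s /=.
by rewrite coneU !delU.
Qed.

Lemma dS_del V (s : seq V) : del V (dS s) = 0.
Proof.
elim: s => [|x s IH] /=; first by rewrite linear0.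
by rewrite linearB /= del_cone delU IH linear0 subr0 subrr.
Qed.

Definition is_face V (s t : seq V) : Prop := (size t).+1 = size s /\ subseq t s.

Lemma carried_dS V (s : seq V) : carried (is_face s) (dS s).
Proof.
elim: s => [|x s IH] /=; first exact: carried0.
apply: carriedB; first by apply: carriedU; split => //; exact: subseq_cons.
apply: carried_lin IH => t [st ts]; rewrite coneU; apply: carriedU.
by split; rewrite /= ?st ?eqxx.
Qed.

Definition smap V W (h : V -> W) : {linear chn V -> chn W} := flift (fun s => << map h s >>).

Lemma smapU V W (h : V -> W) s : smap h << s >> = << map h s >>.
Proof. exact: fliftU. Qed.

Lemma smap_cone V W (h : V -> W) x c : smap h (cone x c) = cone (h x) (smap h c).
Proof.
apply: (@linear_ext C _ _ (smap h \o cone x) (cone (h x) \o smap h)) => s /=.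
by rewrite !(coneU, smapU).
Qed.

Lemma smap_del V W (h : V -> W) c : smap h (del V c) = del W (smap h c).
Proof.
apply: (@linear_ext C _ _ (smap h \o del V) (del W \o smap h)) => s /=.
rewrite smapU !delU; elim: s => [|x s IH] /=; first by rewrite linear0.
by rewrite linearB /= smapU smap_cone IH.
Qed.

Lemma smap_comp V W U (h : V -> W) (h' : W -> U) c : smap h' (smap h c) = smap (h' \o h) c.
Proof.
apply: (@linear_ext C _ _ (smap h' \o smap h) (smap (h' \o h))) => s /=.
by rewrite !smapU map_comp.
Qed.

Lemma smap_carried V W (h : V -> W) (P : set (seq V)) (Q : set (seq W)) c :
  (forall s, P s -> Q (map h s)) -> carried P c -> carried Q (smap h c).
Proof. by move=> PQ; apply: carried_lin => s /PQ Qs; rewrite smapU; apply: carriedU. Qed.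

(* The cone construction of a chain homotopy between two chain maps [f] and
   [g], with apex [a s] for the value on [s]; the fuel [n] is the size of [s]. *)
Section Homotopy.
Variables (V W : choiceType) (f g : {linear chn V -> chn W}) (a : seq V -> W).

Fixpoint homn n (s : seq V) : chn W :=
  if n is m.+1 then
    cone (a s) (f << s >> - g << s >> - flift (homn m) (dS s))
  else 0.

Definition homot : {linear chn V -> chn W} := flift (fun s => homn (size s) s).

Lemma homot_nil : homot << [::] >> = 0.
Proof. by rewrite fliftU. Qed.

Lemma homot_cons s : s != [::] ->
  homot << s >> = cone (a s) (f << s >> - g << s >> - homot (dS s)).
Proof.
case: s => // x s _; rewrite fliftU; congr (cone _ (_ - _)).
apply: (@linear_ext_in C _ _ (is_face (x :: s)) (flift (homn (size s))) homot).
  by move=> t [/= [<-] _]; rewrite !fliftU.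
exact: carried_dS.
Qed.

(** By [del_cone] everything reduces to [f s - g s - homot (dS s)] being a cycle, which follows from
    the identity on the faces of [s] and [dS_del]. The predicate [Q] is there for maps such as
    sorting, which commute with the boundary only on some lists. *)
Lemma homotP_in (Q : set (seq V)) :
  (forall s t, Q s -> is_face s t -> Q t) ->
  (forall s, Q s -> f (dS s) = del W (f << s >>)) ->
  (forall s, Q s -> g (dS s) = del W (g << s >>)) ->
  f << [::] >> = g << [::] >> ->
  forall c, carried Q c -> del W (homot c) + homot (del V c) = f c - g c.
Proof.
move=> Qf fd gd fg0.
suff H n s : Q s -> (size s <= n)%N ->
    del W (homot << s >>) + homot (dS s) = f << s >> - g << s >>.
  apply: (@linear_ext_in C _ _ _ ((del W \o homot) \+ (homot \o del V)) (f \- g)) => s Qs /=.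
  by rewrite delU (H _ _ Qs (leqnn _)).
have [-> _|s0] := eqVneq s [::].
  by rewrite homot_nil fg0 !linear0 addr0 subrr.
elim: n s s0 => [|n IH] s s0 Qs sn; first by case: s s0 sn {Qs}.
rewrite homot_cons // del_cone !linearB /= -fd // -gd //.
have -> : del W (homot (dS s)) = f (dS s) - g (dS s).
  have := @linear_ext_in C _ _ (is_face s) ((del W \o homot) \+ (homot \o del V)) (f \- g)
    _ (dS s).
  rewrite /= dS_del linear0 addr0; apply; last exact: carried_dS.
  move=> t st.
  have [->|t0] := eqVneq t [::]; first by rewrite delU homot_nil fg0 !linear0 addr0 subrr.
  by rewrite delU; apply: IH => //; [exact: Qf st|rewrite -ltnS; case: st => ->].
by rewrite -!linearB subrr linear0 subr0 subrK.
Qed.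

Lemma homotP : (forall c, f (del V c) = del W (f c)) -> (forall c, g (del V c) = del W (g c)) ->
  f << [::] >> = g << [::] >> ->
  forall c, del W (homot c) + homot (del V c) = f c - g c.
Proof.
move=> fd gd fg0 c; apply: (@homotP_in setT) => // s _; first by rewrite -fd delU.
by rewrite -gd delU.
Qed.

(* [A s] constrains the values of [f] and [g] at [s], [B s] those of the
   homotopy; they differ because the latter raises the size. *)
Lemma carried_homot2 (A B : seq V -> set (seq W)) :
  (forall s u, s != [::] -> A s u -> B s (a s :: u)) ->
  (forall s t u, s != [::] -> is_face s t -> B t u -> B s (a s :: u)) ->
  (forall s, carried (A s) (f << s >>)) -> (forall s, carried (A s) (g << s >>)) ->
  forall s, carried (B s) (homot << s >>).
Proof.
move=> AB BB Af Ag s.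
have [n] := ubnP (size s); elim: n s => // n IH s sn.
have [->|s0] := eqVneq s [::]; first by rewrite homot_nil; exact: carried0.
rewrite homot_cons //; apply: (@carried_lin C _ _ (fun u => B s (a s :: u))) => [u Bu|].
  by rewrite coneU; exact: carriedU.
apply: carriedB.
  by apply: carriedB; [apply: carriedW (Af s)|apply: carriedW (Ag s)] => u; apply: AB.
apply: (@carried_lin C _ _ (is_face s)) (@carried_dS V s) => t st.
by apply: carriedW (IH t _) => [u|]; [exact: BB|case: st => <- _ in sn].
Qed.

Lemma carried_homot (A : seq V -> set (seq W)) :
  (forall s t u, is_face s t -> A t u -> A s u) ->
  (forall s u, s != [::] -> A s u -> A s (a s :: u)) ->
  (forall s, carried (A s) (f << s >>)) -> (forall s, carried (A s) (g << s >>)) ->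
  forall s, carried (A s) (homot << s >>).
Proof.
move=> Af Aa; apply: carried_homot2 => // s t u s0 st /(Af s t u st).
exact: Aa.
Qed.

End Homotopy.
End SeqChains.

Section HomotopyNaturality.
Variables (C : comNzRingType) (V W V' W' : choiceType).
Local Notation chn V := {freeg (seq V) / C}.
Variables (f g : {linear chn V -> chn W}) (f' g' : {linear chn V' -> chn W'}).
Variables (a : seq V -> W) (a' : seq V' -> W') (al : V -> V') (be : W -> W').

Lemma homot_natural :
  (forall c, smap C be (f c) = f' (smap C al c)) ->
  (forall c, smap C be (g c) = g' (smap C al c)) ->
  (forall s, s != [::] -> a' (map al s) = be (a s)) ->
  forall c, smap C be (homot f g a c) = homot f' g' a' (smap C al c).
Proof.
move=> ff gg aa; apply: (@linear_ext C _ _ (smap C be \o homot f g a)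
  (homot f' g' a' \o smap C al)) => s.
have [n] := ubnP (size s); elim: n s => // n IH s sn.
have [->|s0] := eqVneq s [::]; first by rewrite /= smapU !homot_nil linear0.
rewrite /= smapU !homot_cons //; last by case: (s) s0.
rewrite smap_cone aa //; congr (cone _ _ _); rewrite !linearB ff gg !smapU; congr (_ - _).
rewrite -[dS C (map al s)]delU -smapU -smap_del delU.
apply: (@linear_ext_in C _ _ (is_face s) (smap C be \o homot f g a)
  (homot f' g' a' \o smap C al)) (@carried_dS C V s).
by move=> t [st _]; apply: IH; rewrite st.
Qed.

Lemma homot_size :
  (forall s, carried (fun u : seq W => size u = size s) (f << s >>)) ->
  (forall s, carried (fun u : seq W => size u = size s) (g << s >>)) ->
  forall s, carried (fun u : seq W => size u = (size s).+1) (homot f g a << s >>).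
Proof.
move=> fS gS; apply: (@carried_homot2 C V W f g a _ (fun s u => size u = (size s).+1)) fS gS.
  by move=> s u _ /= ->.
by move=> s t u _ [<- _] /= ->.
Qed.

End HomotopyNaturality.

(** * Barycentric subdivision *)

(** Stated for finite families rather than segments, because barycentres and points of affine
    simplices are finite convex combinations. *)
Definition convex_closed (R : numDomainType) (V : lmodType R) (Q : set V) :=
  forall (I : finType) (p : I -> R) (x : I -> V), (forall i, 0 <= p i) ->
    \sum_i p i = 1 -> (forall i, Q (x i)) -> Q (\sum_i p i *: x i).

Definition all_in (T : choiceType) (Q : set T) (s : seq T) := forall x, x \in s -> Q x.

Section Subdivision.
Variables (C : comNzRingType) (R : realFieldType).
Implicit Types V W : lmodType R.
Local Notation chn V := {freeg (seq V) / C}.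

Definition bary V (s : seq V) : V := (size s)%:R^-1 *: \sum_(x <- s) x.

Lemma baryE V (s : seq V) :
  bary s = \sum_(i < size s) (size s)%:R^-1 *: nth 0 s i.
Proof. by rewrite /bary -scaler_sumr (big_nth 0) big_mkord. Qed.

Lemma sum_bary V (s : seq V) : s != [::] -> \sum_(i < size s) ((size s)%:R^-1 : R) = 1.
Proof.
move=> s0; rewrite sumr_const card_ord -[LHS]mulr_natl mulfV //.
by rewrite pnatr_eq0 size_eq0.
Qed.

Lemma bary_convex V (Q : set V) s : convex_closed Q -> s != [::] -> all_in Q s -> Q (bary s).
Proof.
move=> Qc s0 sQ; rewrite baryE; apply: Qc; first by move=> i; rewrite invr_ge0.
- exact: sum_bary.
- by move=> i; apply/sQ/mem_nth.
Qed.

Lemma bary_map V W (h : {linear V -> W}) s : bary (map h s) = h (bary s).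
Proof. by rewrite /bary linearZZ (linear_sum h) size_map big_map. Qed.

(** Barycentric subdivision: cone from the barycentre over the subdivided boundary, with the size as
    fuel. Fixing the empty list makes it augmentation preserving. *)
Fixpoint sdn V n (s : seq V) : chn V :=
  if n is m.+1 then cone C (bary s) (flift (sdn m) (dS C s)) else << [::] >>.

Definition sd V : {linear chn V -> chn V} := flift (fun s => sdn (size s) s).

Lemma sd_nil V : sd V << [::] >> = << [::] >>.
Proof. by rewrite fliftU. Qed.

Lemma sd_cons V (s : seq V) : s != [::] -> sd V << s >> = cone C (bary s) (sd V (dS C s)).
Proof.
case: s => // x s _; rewrite fliftU; congr (cone _ _ _).
apply: (@linear_ext_in C _ _ (is_face (x :: s)) (flift (sdn (size s))) (sd V)).
  by move=> t [/= [<-] _]; rewrite !fliftU.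
exact: carried_dS.
Qed.

Lemma sd_del V c : sd V (del C V c) = del C V (sd V c).
Proof.
apply: (@linear_ext C _ _ (sd V \o del C V) (del C V \o sd V)) => s.
have [n] := ubnP (size s); elim: n s => // n IH s sn.
have [->|s0] := eqVneq s [::]; first by rewrite /= sd_nil !delU linear0.
rewrite /= sd_cons // del_cone delU.
suff -> : del C V (sd V (dS C s)) = 0 by rewrite linear0 subr0.
rewrite -[RHS](linear0 (sd V)) -(dS_del C s).
apply/esym; apply: (@linear_ext_in C _ _ (is_face s) (sd V \o del C V) (del C V \o sd V))
  (@carried_dS C V s).
by move=> t [st _]; apply: IH; rewrite st.
Qed.

Lemma sd_natural V W (h : {linear V -> W}) c :
  smap C h (sd V c) = sd W (smap C h c).
Proof.
apply: (@linear_ext C _ _ (smap C h \o sd V) (sd W \o smap C h)) => s.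
have [n] := ubnP (size s); elim: n s => // n IH s sn.
have [->|s0] := eqVneq s [::]; first by rewrite /= smapU !sd_nil smapU.
rewrite /= smapU !sd_cons //; last by case: (s) s0.
rewrite smap_cone bary_map; congr (cone _ _ _).
rewrite -[dS C (map h s)]delU -smapU -smap_del delU.
apply: (@linear_ext_in C _ _ (is_face s) (smap C h \o sd V) (sd W \o smap C h))
  (@carried_dS C V s).
by move=> t [st _]; apply: IH; rewrite st.
Qed.

Lemma sd_carried V (A : seq V -> set (seq V)) :
  A [::] [::] ->
  (forall s t u, s != [::] -> is_face s t -> A t u -> A s (bary s :: u)) ->
  forall s, carried (A s) (sd V << s >>).
Proof.
move=> A0 Ac s.
have [n] := ubnP (size s); elim: n s => // n IH s sn.
have [->|s0] := eqVneq s [::]; first by rewrite sd_nil; exact: carriedU.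
rewrite sd_cons //.
apply: (@carried_lin C _ _ (fun u => A s (bary s :: u))) => [u su|].
  by rewrite coneU; apply: carriedU.
apply: (@carried_lin C _ _ (is_face s)) (@carried_dS C V s) => t st.
by apply: carriedW (IH t _) => [u|]; [exact: Ac|case: st => <- _ in sn].
Qed.

Lemma sd_size V s : carried (fun u : seq V => size u = size s) (sd V << s >>).
Proof.
apply: (@sd_carried V (fun s u => size u = size s)) => // {}s t u _ [st _] /= ->.
by rewrite st.
Qed.

Lemma sd_convex V (Q : set V) s : convex_closed Q -> all_in Q s ->
  carried (all_in Q) (sd V << s >>).
Proof.
move=> Qc sQ.
have H := @sd_carried V (fun s u => all_in Q s -> all_in Q u).
apply: carriedW (H _ _ s) => [u|//|{sQ}s t u s0 [_ ts] tu sQ x]; first exact.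
rewrite inE => /predU1P[->|xu]; first exact: bary_convex.
by apply: tu xu => y /(mem_subseq ts) /sQ.
Qed.

Definition sdN V N : {linear chn V -> chn V} :=
  iter N (fun f : {linear chn V -> chn V} => sd V \o f) idfun.

Lemma sdNS V N c : sdN V N.+1 c = sd V (sdN V N c). Proof. by []. Qed.

Lemma sdN_del V N c : sdN V N (del C V c) = del C V (sdN V N c).
Proof. by elim: N => // N IH; rewrite !sdNS IH sd_del. Qed.

Lemma sdN_natural V W (h : {linear V -> W}) N c :
  smap C h (sdN V N c) = sdN W N (smap C h c).
Proof. by elim: N => // N IH; rewrite !sdNS -IH sd_natural. Qed.

Lemma sdN_nil V N : sdN V N << [::] >> = << [::] >>.
Proof. by elim: N => // N IH; rewrite sdNS IH sd_nil. Qed.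

Lemma sdN_size V N s : carried (fun u : seq V => size u = size s) (sdN V N << s >>).
Proof.
elim: N => [|N IH]; first exact: carriedU.
by rewrite sdNS; apply: carried_lin IH => u <-; exact: sd_size.
Qed.

Lemma sdN_convex V (Q : set V) N s : convex_closed Q -> all_in Q s ->
  carried (all_in Q) (sdN V N << s >>).
Proof.
move=> Qc sQ; elim: N => [|N IH]; first exact: carriedU.
by rewrite sdNS; apply: carried_lin IH => u uQ; exact: sd_convex.
Qed.

End Subdivision.

Section Mesh.
Variables (C : comNzRingType) (R : realType) (V : normedModType R).

Definition mesh_le (d : R) (s : seq V) := forall x y, x \in s -> y \in s -> `|x - y| <= d.

Lemma ball_convex (x : V) d : convex_closed [set y | `|x - y| <= d].
Proof.
move=> I p y p0 p1 yd /=.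
rewrite -[x]scale1r -p1 scaler_suml -sumrB.
apply: le_trans (ler_norm_sum _ _ _) _.
rewrite -[d]mul1r -p1 mulr_suml; apply: ler_sum => i _.
by rewrite -scalerBr normrZ ger0_norm // ler_wpM2l //; exact: yd.
Qed.

(** [bary s - x] is the average of the differences to [x], one of which is zero; this is the source
    of the contraction factor. *)
Lemma bary_dist (s : seq V) d x : mesh_le d s -> x \in s ->
  `|bary s - x| <= (1 - (size s)%:R^-1) * d.
Proof.
move=> sd xs; have s0 : s != [::] by case: (s) xs.
have d0 : 0 <= d by have := sd x x xs xs; rewrite subrr normr0.
have ix : (index x s < size s)%N by rewrite index_mem.
have := sum_bary s0; rewrite baryE; set c : R := (size s)%:R^-1 => c1.
have c0 : 0 <= c by rewrite invr_ge0.
rewrite -[x in _ - x]scale1r -{1}c1 scaler_suml -sumrB.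
rewrite (bigD1 (Ordinal ix)) //= nth_index // subrr add0r.
apply: le_trans (ler_norm_sum _ _ _) _.
apply: (@le_trans _ _ (\sum_(i < size s | i != Ordinal ix) c * d)).
  apply: ler_sum => i _; rewrite -scalerBr normrZ ger0_norm //.
  by rewrite ler_wpM2l // sd // mem_nth.
rewrite -mulr_suml ler_wpM2r //.
by move/eqP: c1; rewrite (bigD1 (Ordinal ix)) //= addrC eq_sym -subr_eq => /eqP ->.
Qed.

(** The factor is expressed by a bound [K] on the size, since the recursion passes to smaller faces,
    whose own factors are better. *)
Lemma sd_mesh (K : nat) d (s : seq V) : (size s <= K)%N -> 0 <= d -> mesh_le d s ->
  carried (mesh_le ((1 - K%:R^-1) * d)) (sd C V << s >>).
Proof.
move=> sK d0 sd.
(* The second conjunct keeps the subdivided faces inside every convex set containing [s], in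
   particular inside a ball around the barycentre. *)
have H := @sd_carried C R V (fun s u => ((size s <= K)%N -> mesh_le d s ->
  mesh_le ((1 - K%:R^-1) * d) u) /\
  (forall Q : set V, convex_closed Q -> all_in Q s -> all_in Q u)).
apply: carriedW (H _ _ s) => [u [/(_ sK sd)]|//|{sK sd}s t u s0 [st ts] [tm tQ]]; first exact.
split=> [sK sd|Q Qc sQ x]; last first.
  rewrite inE => /predU1P[->|xu]; first exact: bary_convex.
  by apply: tQ xu => // y /(mem_subseq ts) /sQ.
have bu y : y \in u -> `|bary s - y| <= (1 - K%:R^-1) * d.
  move: y; apply: (tQ _ (@ball_convex _ _)) => y /(mem_subseq ts) ys /=.
  apply: le_trans (bary_dist sd ys) _; rewrite ler_wpM2r // lerD2l lerN2.
  have s1 : (0 < size s)%N by rewrite lt0n size_eq0.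
  by rewrite lef_pV2 ?ler_nat // posrE ltr0n // (leq_trans s1).
have tm' : mesh_le ((1 - K%:R^-1) * d) u.
  apply: tm => [|x y xt yt]; first by apply: leq_trans sK; rewrite -st.
  by apply: sd; exact: (mem_subseq ts).
have Kd : 0 <= (1 - K%:R^-1) * d.
  have K0 : (0 < K)%N by apply: leq_trans sK; rewrite lt0n size_eq0.
  by rewrite mulr_ge0 // subr_ge0 invf_le1 ?ler1n ?ltr0n.
move=> x y; rewrite !inE => /predU1P[->|xu] /predU1P[->|yu].
- by rewrite subrr normr0.
- exact: bu.
- by rewrite distrC; exact: bu.
- exact: tm'.
Qed.

Lemma sdN_mesh (K : nat) d (s : seq V) N : size s = K -> 0 <= d -> mesh_le d s ->
  carried (mesh_le ((1 - K%:R^-1) ^+ N * d)) (sdN C V N << s >>).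
Proof.
move=> sK d0 sm; elim: N => [|N IH]; first by apply: carriedU; rewrite expr0 mul1r.
have IH' := carriedI IH (@sdN_size C R V N s).
rewrite sdNS; apply: carried_lin IH' => u [um us].
rewrite exprS -mulrA; apply: sd_mesh => //; first by rewrite us sK.
apply: mulr_ge0 => //; apply: exprn_ge0; rewrite subr_ge0.
case: (K) => [|n]; first by rewrite invr0.
by rewrite invf_le1 ?ler1n ?ltr0n.
Qed.

Lemma sdN_small (K : nat) d eps : (0 < K)%N -> 0 < eps -> 0 <= d ->
  exists N, forall s : seq V, size s = K -> mesh_le d s ->
  forall M, (N <= M)%N -> carried (mesh_le eps) (sdN C V M << s >>).
Proof.
move=> K0 e0 d0; set q : R := 1 - K%:R^-1.
have q0 : 0 <= q by rewrite subr_ge0 invf_le1 ?ler1n ?ltr0n.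
have q1 : `|q| < 1 by rewrite ger0_norm // /q ltrBlDr ltrDl invr_gt0 ltr0n.
have /cvgrPdist_lt/(_ _ e0) [N _ HN] := cvg_geometric d q1.
exists N => s sK sd M NM; apply: carriedW (sdN_mesh sK d0 sd) => u um x y xu yu.
apply: le_trans (um x y xu yu) _.
have /= := HN M NM; rewrite sub0r normrN /geometric /= ger0_norm;
  last by rewrite mulr_ge0 // exprn_ge0.
by rewrite mulrC => /ltW.
Qed.

End Mesh.

(** * Chains on sequences as simplicial and singular chains *)

Section Faces.
Variable C : comNzRingType.

Definition rem_at (V : Type) i (s : seq V) := take i s ++ drop i.+1 s.

Lemma nth_rem_at (V : Type) (x0 : V) i s j : nth x0 (rem_at i s) j = nth x0 s (bump i j).
Proof.
rewrite nth_cat size_take /bump; have [si|si] := ltnP i (size s).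
  by have [ij|ij] := leqP i j; [rewrite nth_drop addSn subnKC|rewrite nth_take].
have [js|js] := ltnP j (size s).
  by rewrite leqNgt (leq_trans js si) nth_take ?add0n // (leq_trans js si).
by rewrite nth_drop !nth_default //; [rewrite (leq_trans js) // leq_addl
  |rewrite addSn ltnW // ltnS (leq_trans si) // leq_addr].
Qed.

Lemma size_rem_at (V : Type) i (s : seq V) : (i < size s)%N -> (size (rem_at i s)).+1 = size s.
Proof.
by move=> si; rewrite size_cat size_take si size_drop -addnS -subSn // subSS subnKC // ltnW.
Qed.

Lemma dS_sum (V : choiceType) (s : seq V) :
  dS C s = \sum_(i < size s) (-1) ^+ i *: << rem_at i s >>.
Proof.
elim: s => [|x s IH]; first by rewrite big_ord0.
rewrite big_ord_recl expr0 scale1r /= IH linear_sum -sumrN; congr (<< _ >> + _).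
  by rewrite /rem_at /= drop0.
by apply: eq_bigr => i _; rewrite linearZ /= coneU exprS mulN1r scaleNr.
Qed.

Variable S : semisimplicial.
Local Notation chn V := {freeg (seq V) / C}.

Definition bdl k : {linear chain C S k.+1 -> chain C S k} :=
  flift (fun s : S k.+1 => \sum_(i < k.+2) (-1) ^+ i *: << face i s >>).

Lemma bdE k (c : chain C S k.+1) : bd c = bdl k c.
Proof. by rewrite /bd fliftE. Qed.

(** One criterion for all ways of reading lists as simplices: as tuples, as realizations of lists of
    points, and as affine simplices on vertices of K_n. *)
Lemma bd_seq (V : choiceType) (F : forall k, seq V -> S k) k :
  (forall (i : 'I_k.+2) s, size s = k.+2 -> face i (F k.+1 s) = F k (rem_at i s)) ->
  forall c : chn V, carried (fun s : seq V => size s = k.+2) c ->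
  bdl k (flift (fun s => << F k.+1 s >>) c) = flift (fun s => << F k s >>) (del C V c).
Proof.
move=> Fface; pose FF m : {linear chn V -> chain C S m} := flift (fun s => << F m s >>).
apply: (@linear_ext_in C _ _ _ (bdl k \o FF k.+1) (FF k \o del C V)) => s sk /=.
rewrite delU /FF !fliftU dS_sum linear_sum sk; apply: eq_bigr => i _.
by rewrite linearZ /= fliftU Fface.
Qed.

End Faces.

Section TupleChains.
Variables (C : comNzRingType) (n : nat).
Local Notation P := (setpair n).
Local Notation chn V := {freeg (seq V) / C}.
Local Notation S := (setpair_tuples n).

(** Faithful only on lists of size [k.+1]; other lists are truncated or padded with the empty
    pair. *)
Definition tup k (s : seq P) : S k := [tuple nth (finset.set0, finset.set0) s i | i < k.+1].

Definition toseq k : {linear chain C S k -> chn P} :=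
  flift (fun s : k.+1.-tuple P => << val s >>).
Definition totup k : {linear chn P -> chain C S k} := flift (fun s => << tup k s >>).

Lemma val_tup k (s : seq P) : size s = k.+1 -> val (tup k s) = s.
Proof.
move=> sk; apply: (@eq_from_nth _ (finset.set0, finset.set0)) => [|i].
  by rewrite size_tuple sk.
rewrite size_tuple => ik; rewrite -(tnth_nth _ _ (Ordinal ik)).
by rewrite tnth_mktuple.
Qed.

Lemma tup_val k (s : k.+1.-tuple P) : tup k s = s.
Proof. by apply: val_inj; rewrite val_tup // size_tuple. Qed.

Lemma toseqK k c : totup k (toseq k c) = c.
Proof.
apply: (@linear_ext C _ _ (totup k \o toseq k) idfun) => s /=.
by rewrite /toseq /totup !fliftU tup_val.
Qed.

Lemma totupK k c : carried (fun s : seq P => size s = k.+1) c -> toseq k (totup k c) = c.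
Proof.
apply: (@linear_ext_in C _ _ _ (toseq k \o totup k) idfun) => s sk /=.
by rewrite /toseq /totup !fliftU val_tup.
Qed.

Lemma toseq_carried k (Q : set (seq P)) c :
  carried (fun s : k.+1.-tuple P => Q s) c -> carried Q (toseq k c).
Proof. by apply: carried_lin => s Qs; rewrite fliftU; apply: carriedU. Qed.

Lemma toseq_size k c : carried (fun s : seq P => size s = k.+1) (toseq k c).
Proof.
apply: (@carried_lin _ _ _ setT) => // s _; rewrite fliftU.
by apply: carriedU; rewrite /= size_tuple.
Qed.

Lemma totup_carried k (Q : set (seq P)) c : carried (fun s => Q s /\ size s = k.+1) c ->
  carried (fun s : k.+1.-tuple P => Q s) (totup k c).
Proof.
by apply: carried_lin => s [Qs sk]; rewrite fliftU; apply: carriedU;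
  rewrite -[X in Q X]/(val (tup k s)) val_tup.
Qed.

Lemma bd_totup k c : carried (fun s : seq P => size s = k.+2) c ->
  bdl C S k (totup k.+1 c) = totup k (del C _ c).
Proof.
apply: (@bd_seq C S P (fun k s => tup k s)) => i s sk.
apply/eq_from_tnth => j; rewrite !tnth_mktuple nth_rem_at //=.
Qed.

Lemma bd_toseq k c : toseq k (bdl C S k c) = del C _ (toseq k.+1 c).
Proof.
rewrite -{1}[c]toseqK bd_totup ?totupK //; last exact: toseq_size.
apply: carried_lin (@toseq_size k.+1 c) => s sk.
by rewrite delU => t /carried_dS[]; rewrite sk => -[].
Qed.

(** The augmentation is the boundary into the empty list, so reduced cycles of degree zero are
    handled like those of higher degree. *)
Lemma aug_toseq c : del C _ (toseq 0 c) = augmentation c *: << [::] >>.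
Proof.
rewrite /augmentation fliftE [c]freeg_decomp !linear_sum scaler_suml.
apply: eq_bigr => s _; rewrite !linearZ /= !fliftU -[_ *: 1 : C^o]/(_ * 1) mulr1.
congr (_ *: _); case: s => -[|x [|y s]] //= _.
by rewrite linear0 subr0.
Qed.

End TupleChains.

(** * Affine realization of lists of points *)

Section Realize.
Variables (C : comNzRingType) (R : realType) (n : nat).
Local Notation T := 'rV[R]_n.
Local Notation chn V := {freeg (seq V) / C}.
Local Notation S := (singular R T).

Definition aff (V : lmodType R) k (q : seq V) (t : 'rV[R]_k.+1) : V :=
  \sum_(i < k.+1) t 0 i *: nth 0 q i.

Definition realize (V : lmodType R) (g : V -> T) k : {linear chn V -> chain C S k} :=
  flift (fun q => << (fun t => g (aff q (val t))) : S k >>).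

Lemma realizeU (V : lmodType R) (g : V -> T) k q :
  realize g k << q >> = << (fun t => g (aff q (val t))) : S k >>.
Proof. exact: fliftU. Qed.

Lemma coface_aff (V : lmodType R) k (i : 'I_k.+2) (q : seq V) t :
  aff q (coface_mx i t) = aff (rem_at i q) t.
Proof.
rewrite /aff (bigD1_ord i) //= mxE unlift_none scale0r add0r.
by apply: eq_bigr => j _; rewrite mxE liftK nth_rem_at.
Qed.

Lemma bd_realize (V : lmodType R) (g : V -> T) k c :
  carried (fun s : seq V => size s = k.+2) c ->
  bdl C S k (realize g k.+1 c) = realize g k (del C V c).
Proof.
apply: (@bd_seq C S V (fun k q t => g (aff q (val t)))) => i s sk.
by apply/funext => t /=; rewrite coface_aff.
Qed.

Lemma aff_map (V W : lmodType R) (h : {linear V -> W}) k (q : seq V) (t : 'rV_k.+1) :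
  aff (map h q) t = h (aff q t).
Proof.
rewrite /aff linear_sum; apply: eq_bigr => i _; rewrite linearZ /=; congr (_ *: _).
have [iq|iq] := ltnP i (size q); first by rewrite (nth_map 0).
by rewrite !nth_default ?size_map // linear0.
Qed.

Lemma realize_map (V W : lmodType R) (h : {linear V -> W}) (g : W -> T) k c :
  realize g k (smap C h c) = realize (g \o h) k c.
Proof.
apply: (@linear_ext C _ _ (realize g k \o smap C h) (realize (g \o h) k)) => s.
rewrite /= smapU !realizeU; congr << _ >>; apply/funext => t /=.
by rewrite aff_map.
Qed.

End Realize.

(** * Standard simplices and their faces as models *)

Section Models.
Variable R : realType.
Local Notation Vm k := 'rV[R]_k.+1.

Lemma coface_mx_linear k (i : 'I_k.+2) : linear (@coface_mx R k i).
Proof.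
move=> a x y; apply/rowP => j; rewrite !mxE.
by case: unlift => [j'|]; rewrite ?mxE // mulr0 addr0.
Qed.

HB.instance Definition _ k (i : 'I_k.+2) :=
  GRing.isLinear.Build R (Vm k) (Vm k.+1) _ (@coface_mx R k i) (coface_mx_linear i).

Definition fundamental k : seq (Vm k) := [seq delta_mx 0 i | i <- enum 'I_k.+1].

Lemma size_fundamental k : size (fundamental k) = k.+1.
Proof. by rewrite size_map size_enum_ord. Qed.

Lemma nth_fundamental k (i : 'I_k.+1) : nth 0 (fundamental k) i = delta_mx 0 i.
Proof. by rewrite (nth_map i) ?size_enum_ord // nth_ord_enum. Qed.

Lemma aff_fundamental k (t : Vm k) : aff (fundamental k) t = t.
Proof.
rewrite {2}(row_sum_delta t); apply: eq_bigr => i _.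
by rewrite nth_fundamental.
Qed.

Lemma fundamental_face k (i : 'I_k.+2) :
  rem_at i (fundamental k.+1) = map (coface_mx i) (fundamental k).
Proof.
have sz : size (rem_at i (fundamental k.+1)) = k.+1.
  by apply: succn_inj; rewrite size_rem_at size_fundamental.
apply: (@eq_from_nth _ 0); first by rewrite sz size_map size_fundamental.
rewrite sz => j jk.
rewrite nth_rem_at [RHS](nth_map 0) ?size_fundamental //.
have -> : nth 0 (fundamental k) j = delta_mx 0 (Ordinal jk) := nth_fundamental (Ordinal jk).
rewrite -[bump i j]/(val (fintype.lift i (Ordinal jk))) nth_fundamental.
apply/rowP => m; rewrite !mxE /=; case: unliftP => [m' ->|->].
  by rewrite mxE /= (inj_eq lift_inj).
by rewrite (negbTE (neq_lift _ _)).
Qed.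

Lemma dS_fundamental (C : comNzRingType) k :
  dS C (fundamental k.+1) = \sum_(i < k.+2) (-1) ^+ i *: smap C (coface_mx i) << fundamental k >>.
Proof.
rewrite dS_sum size_fundamental; apply: eq_bigr => i _.
by rewrite smapU fundamental_face.
Qed.

Lemma coface_simplex k (i : 'I_k.+2) (x : Vm k) :
  (coface_mx i x \in @stdsimplex R k.+1) = (x \in @stdsimplex R k).
Proof.
have sE : \sum_j coface_mx i x 0 j = \sum_j x 0 j.
  rewrite (bigD1_ord i) //= mxE unlift_none add0r.
  by apply: eq_bigr => j _; rewrite mxE liftK.
apply/idP/idP; rewrite !inE => -[x0 x1]; split; rewrite -?sE // ?sE //.
  by move=> j; have := x0 (fintype.lift i j); rewrite mxE liftK.
by move=> j; rewrite mxE; case: unlift.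
Qed.

End Models.

(** * Natural operations on singular chains *)

Section SingularHomotopy.
Variables (C : comNzRingType) (R : realType) (n : nat).
Local Notation T := 'rV[R]_n.
Local Notation chn V := {freeg (seq V) / C}.
Local Notation S := (singular R T).
Local Notation Vm k := 'rV[R]_k.+1.
Local Notation Wm k := ('rV[R]_k.+1 * R^o)%type.

Definition cyl_face k (i : 'I_k.+2) (p : Wm k) : Wm k.+1 := (coface_mx i p.1, p.2).

Lemma cyl_face_linear k (i : 'I_k.+2) : linear (cyl_face i).
Proof. by move=> a x y; rewrite /cyl_face /= linearP. Qed.

HB.instance Definition _ k (i : 'I_k.+2) :=
  GRing.isLinear.Build R (Wm k) (Wm k.+1) _ (cyl_face i) (cyl_face_linear i).

(** [G s] is a map on the cylinder over the model simplex of [s], the second coordinate being the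
    height. It is later instantiated by [ext_fst], which ignores the height, and by the
    straight-line homotopy [segment]. *)
Variable G : forall k, S k -> Wm k -> T.
Hypothesis G_face : forall k (i : 'I_k.+2) (s : S k.+1) p,
  G (face i s) p = G s (cyl_face i p).

(* Chains [u_k] on the models, natural in the cofaces, act on singular chains
   through their value on the fundamental simplex [fundamental k]. *)
Definition sing_op (u : forall k, {linear chn (Vm k) -> chn (Wm k)}) k m :
    {linear chain C S k -> chain C S m} :=
  flift (fun s => realize C (G s) m (u k << fundamental R k >>)).

Lemma sing_opU u k m s :
  sing_op u k m << s >> = realize C (G s) m (u k << fundamental R k >>).
Proof. exact: fliftU. Qed.

Definition model_natural (u : forall k, {linear chn (Vm k) -> chn (Wm k)}) :=
  forall k (i : 'I_k.+2) c, smap C (cyl_face i) (u k c) = u k.+1 (smap C (coface_mx i) c).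

(** Naturality moves the faces of [s] onto the faces of the model, so that identities between
    operations have to be checked only on the fundamental simplex. *)
Lemma sing_op_bd u k m s : model_natural u ->
  sing_op u k m (bdl C S k << s >>) = realize C (G s) m (u k.+1 (dS C (fundamental R k.+1))).
Proof.
move=> un; rewrite /bdl fliftU dS_fundamental !linear_sum; apply: eq_bigr => i _.
rewrite !linearZ /= -un realize_map sing_opU; congr (_ *: realize _ _ _ _).
by apply/funext => p; rewrite G_face.
Qed.

Section Chains.
Variables f g : forall k, {linear chn (Vm k) -> chn (Wm k)}.
Hypotheses (f_nat : model_natural f) (g_nat : model_natural g).
Hypothesis fd : forall k c, f k (del C _ c) = del C _ (f k c).
Hypothesis gd : forall k c, g k (del C _ c) = del C _ (g k c).
Hypothesis f_size : forall k s, carried (fun u : seq (Wm k) => size u = size s) (f k << s >>).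
Hypothesis g_size : forall k s, carried (fun u : seq (Wm k) => size u = size s) (g k << s >>).

Lemma sing_op_chain k z :
  bdl C S k (sing_op f k.+1 k.+1 z) = sing_op f k k (bdl C S k z).
Proof.
apply: (@linear_ext C _ _ (bdl C S k \o sing_op f k.+1 k.+1) (sing_op f k k \o bdl C S k))
  => s /=.
rewrite sing_op_bd // sing_opU bd_realize -?fd ?delU //.
by move=> u /f_size ->; rewrite size_fundamental.
Qed.

Variable a : forall k, seq (Vm k) -> Wm k.
Hypothesis a_nat : forall k (i : 'I_k.+2) s, s != [::] ->
  a (map (coface_mx i) s) = cyl_face i (a s).
Hypothesis fg0 : forall k, f k << [::] >> = g k << [::] >>.

Let h k : {linear chn (Vm k) -> chn (Wm k)} := homot (f k) (g k) (@a k).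

Lemma sing_homotopy0 z :
  bdl C S 0 (sing_op h 0 1 z) = sing_op f 0 0 z - sing_op g 0 0 z.
Proof.
apply: (@linear_ext C _ _ (bdl C S 0 \o sing_op h 0 1) (sing_op f 0 0 \- sing_op g 0 0)) => s /=.
rewrite !sing_opU bd_realize; last first.
  by move=> u /(homot_size (@f_size _) (@g_size _)) ->; rewrite size_fundamental.
rewrite -linearB /= -(homotP (@a 0) (@fd 0) (@gd 0)) //.
(* In degree zero the boundary of the model is the empty list, on which the homotopy vanishes. *)
suff -> : h 0 (del C _ << fundamental R 0 >>) = 0 by rewrite addr0.
rewrite delU; have := size_fundamental R 0; case: (fundamental R 0) => // x [] //= _.
by rewrite linear0 subr0 /h homot_nil.
Qed.

Lemma sing_homotopyS k z :
  bdl C S k.+1 (sing_op h k.+1 k.+2 z) + sing_op h k k.+1 (bdl C S k z) =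
  sing_op f k.+1 k.+1 z - sing_op g k.+1 k.+1 z.
Proof.
apply: (@linear_ext C _ _ ((bdl C S k.+1 \o sing_op h k.+1 k.+2)
  \+ (sing_op h k k.+1 \o bdl C S k))
   (sing_op f k.+1 k.+1 \- sing_op g k.+1 k.+1)) => s /=.
have hn : model_natural h by move=> m i c; apply: homot_natural => // ?; exact: a_nat.
rewrite sing_op_bd // !sing_opU bd_realize; last first.
  by move=> u /(homot_size (@f_size _) (@g_size _)) ->; rewrite size_fundamental.
by rewrite -linearD -linearB /= -delU -(homotP (@a k.+1) (@fd k.+1) (@gd k.+1)).
Qed.

End Chains.
End SingularHomotopy.

(** * Small singular simplices *)

Section StandardSimplex.
Variable R : realType.

Lemma stdsimplexP k (t : @stdsimplex R k) : (forall i, 0 <= val t 0 i) /\ \sum_i val t 0 i = 1.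
Proof. exact: (set_mem (valP t)). Qed.

Lemma aff_convex k (V : lmodType R) (Q : set V) (q : seq V) (t : @stdsimplex R k) :
  convex_closed Q -> size q = k.+1 -> all_in Q q -> Q (aff q (val t)).
Proof.
move=> Qc qk qQ; have [t0 t1] := stdsimplexP t.
by apply: Qc => // i; apply/qQ/mem_nth; rewrite qk.
Qed.

Lemma stdsimplex_convex k : convex_closed (@stdsimplex R k).
Proof.
move=> I p x p0 p1 xs; split=> [j|].
  rewrite summxE sumr_ge0 // => i _; rewrite mxE mulr_ge0 //.
  by have [->] := xs i.
under eq_bigr do rewrite summxE; rewrite exchange_big /= -p1.
apply: eq_bigr => i _; under eq_bigr do rewrite mxE.
by rewrite -mulr_sumr; have [_ ->] := xs i; rewrite mulr1.
Qed.

Lemma stdsimplex_norm k (x : 'rV[R]_k.+1) : stdsimplex x -> `|x| <= 1.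
Proof.
move=> [x0 x1]; rewrite /Num.norm /= mx_normrE; apply/bigmax_leP; split=> // -[a j] _ /=.
by rewrite ord1 ger0_norm // -x1 (bigD1 j) //= lerDl sumr_ge0.
Qed.

Lemma stdsimplex_compact k : compact (@stdsimplex R k).
Proof.
apply: bounded_closed_compact.
  exists 1; split; first exact: num_real.
  by move=> M M1 x xs; apply: le_trans (stdsimplex_norm xs) (ltW M1).
have -> : @stdsimplex R k = (\bigcap_(i in [set: 'I_k.+1]) ((fun x :
  'rV[R]_k.+1 => x 0 i) @^-1` [set y | 0 <= y]))
    `&` ((fun x : 'rV[R]_k.+1 => \sum_i x 0 i) @^-1` [set 1]).
  by apply/seteqP; split=> x [h1 h2]; split=> //= i; [move=> _; exact: h1|exact: h1].
apply: closedI.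
  apply: closed_bigI => i _; apply: closed_comp; last exact: closed_ge.
  by move=> x _; exact: coord_continuous.
apply: closed_comp; last exact: closed_eq.
have sc : continuous (fun x : 'rV[R]_k.+1 => \sum_i x 0 i : R^o).
  apply: continuous_big => [|i _]; first exact: add_continuous.
  exact: coord_continuous.
by move=> x _; exact: sc.
Qed.

Variable n : nat.
Local Notation T := 'rV[R]_n.

Lemma simplex_continuousP k (s : @stdsimplex R k -> T) : continuous s <->
  forall p eps, 0 < eps -> exists2 d, 0 < d & forall q, `|val p - val q| < d ->
    `|s p - s q| < eps.
Proof.
split=> [cs p eps eps0|H p].
  have /cvgrPdist_lt/(_ _ eps0) := cs p.
  move=> /nbhs_ballP[d d0 dP]; exists d => // q pq; apply: dP.
  by rewrite -initial_ballE -ball_normE.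
apply: (iffRL (@cvgrPdist_lt R T _ _ (nbhs_filter p) s (s p))) => eps eps0;
  have [d d0 dP] := H p eps eps0.
apply/nbhs_ballP; exists d => // q; rewrite -initial_ballE -ball_normE.
exact: dP.
Qed.

Lemma simplex_unif_continuous k (s : @stdsimplex R k -> T) eps : continuous s -> 0 < eps ->
  exists2 d, 0 < d & forall p q, `|val p - val q| <= d -> `|s p - s q| < eps.
Proof.
move=> /simplex_continuousP cs eps0.
have := @stdsimplex_compact k; rewrite compact_near_coveringP => nc.
(* Heine-Cantor through near coverings. Compactness is that of a subset of the ambient space,
   whereas [s] is defined on the subtype, so [Q] quantifies over the points [p] lying above [x]. *)
pose Q (d : R) (x : 'rV[R]_k.+1) := forall p q : @stdsimplex R k, val p = x ->
  `|x - val q| < d -> `|s p - s q| < eps.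
have cov x : stdsimplex x -> \forall x' \near x & i \near 0^'+, Q i x'.
  move=> xs; pose p : @stdsimplex R k := exist _ x (mem_set xs).
  have [d d0 dP] := cs p (eps / 2) (divr_gt0 eps0 (ltr0Sn _ _)).
  exists (ball x (d / 2), [set e : R | e < d / 2]).
    split => /=; first by apply: nbhsx_ballx; rewrite divr_gt0.
    by apply: nbhs_right_lt; rewrite divr_gt0.
  move=> [x' e]; rewrite -ball_normE /= => -[xx' ed] p' q px' pq.
  rewrite (splitr eps); apply: le_lt_trans (ler_distD (s p) _ _) _.
  rewrite ltrD //; last first.
    apply: dP; rewrite /= -(subrK x' x) -addrA (splitr d).
    by apply: le_lt_trans (ler_normD _ _) _; rewrite ltrD // (lt_trans pq).
  rewrite distrC; apply: dP; rewrite /= px'.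
  by apply: lt_trans xx' _; rewrite ltr_pdivrMr // ltr_pMr // ltr1n.
have [d [/= d0 dP]] := filter_ex (filterI (nbhs_right_gt (0 : R)) (nc R 0^'+ Q _ cov)).
exists (d / 2); first by rewrite divr_gt0.
move=> p q pq; apply: (dP (val p)) => //; first by have := valP p; rewrite inE.
apply: le_lt_trans pq _.
by rewrite ltr_pdivrMr // ltr_pMr // ltr1n.
Qed.

Lemma continuous_comp_simplex k m (s : @stdsimplex R k -> T) (f : @stdsimplex R m ->
  @stdsimplex R k) :
  continuous s -> continuous f -> continuous (s \o f).
Proof. by move=> cs cf x; apply: continuous_comp; [exact: cf|exact: cs]. Qed.

Lemma aff_continuous (W : normedModType R) k (q : seq W) :
  continuous (fun t : @stdsimplex R k => aff q (val t)).
Proof.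
apply: continuous_big => [|i _]; first exact: add_continuous.
move=> t.
apply: (@continuousZ R W _ (fun t : @stdsimplex R k => val t 0 i) (fun=> nth 0 q i));
  last exact: cst_continuous.
apply: (@continuous_comp _ _ _ (@set_val _ (@stdsimplex R k)) (fun x : 'rV[R]_k.+1 => x 0 i)).
  exact: initial_continuous.
exact: coord_continuous.
Qed.

Lemma into_simplex_continuous k m (f : @stdsimplex R m -> @stdsimplex R k) :
  continuous (fun t => val (f t)) -> continuous f.
Proof. exact: continuous_comp_initial. Qed.

End StandardSimplex.

Section AffineMaps.
Variables (R : realType) (V : lmodType R).
Implicit Types q : seq V.

Lemma aff_linear k q : linear (@aff R V k q).
Proof.
move=> a x y; rewrite /aff scaler_sumr -big_split; apply: eq_bigr => i _ /=.
by rewrite !mxE scalerDl scalerA.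
Qed.

HB.instance Definition _ k q := GRing.isLinear.Build R 'rV[R]_k.+1 V _ (@aff R V k q)
  (aff_linear q).

Lemma aff_delta k q (i : 'I_k.+1) : aff q (delta_mx 0 i) = nth 0 q i :> V.
Proof.
rewrite /aff (bigD1 i) //= mxE !eqxx scale1r big1 ?addr0 // => j ji.
by rewrite mxE (negbTE ji) andbF scale0r.
Qed.

Lemma map_aff_fundamental k q : size q = k.+1 -> map (aff q) (fundamental R k) = q.
Proof.
move=> qk; apply: (@eq_from_nth _ 0); first by rewrite size_map size_fundamental.
move=> i; rewrite size_map size_fundamental => ik; rewrite (nth_map 0) ?size_fundamental //.
by rewrite (nth_fundamental R (Ordinal ik)) aff_delta.
Qed.

Lemma aff_pair k (Q : seq (V * R^o)) (t : 'rV[R]_k.+1) :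
  aff Q t = (aff (map fst Q) t, aff (map snd Q) t).
Proof.
have H (i : nat) : nth 0 Q i = (nth 0 (map fst Q) i, nth 0 (map snd Q) i).
  have [iQ|iQ] := ltnP i (size Q); last by rewrite !nth_default ?size_map.
  by rewrite !(nth_map 0) // -surjective_pairing.
rewrite /aff; elim/big_rec3 : _ => // i x y z _ ->.
by rewrite H.
Qed.

End AffineMaps.

Section Extension.
Variables (R : realType) (n : nat).
Local Notation T := 'rV[R]_n.
Local Notation S := (singular R T).

(* Extension by the junk value [0] outside of the standard simplex. *)
Definition sext k (s : S k) (x : 'rV[R]_k.+1) : T :=
  if insub x is Some p then (s : @stdsimplex R k -> T) p else 0.

Lemma sextE k (s : S k) (p : @stdsimplex R k) : sext s (val p) = (s : @stdsimplex R k -> T) p.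
Proof. by rewrite /sext valK. Qed.

(** True outside the simplex as well, because a coface both preserves and reflects membership in the
    standard simplex. *)
Lemma sext_face k (s : S k.+1) (i : 'I_k.+2) x : sext (face i s) x = sext s (coface_mx i x).
Proof.
rewrite /sext; case: insubP => [p xs px|/negbTE xs].
  rewrite insubT ?coface_simplex // => h /=; congr (s _).
  by apply: val_inj; rewrite /= px.
by rewrite insubF ?coface_simplex.
Qed.

Lemma singular_inP (X : set T) k (s : @stdsimplex R k -> T) :
  continuous s -> (forall p, X (s p)) -> @singular_in R T X k s.
Proof. by move=> cs Xs; split=> // _ [p _ <-]. Qed.

Lemma singular_in_cont (X : set T) k (s : S k) : @singular_in R T X k s ->
  continuous (s : @stdsimplex R k -> T).
Proof. by case. Qed.

Lemma singular_in_im (X : set T) k (s : S k) p : @singular_in R T X k s ->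
  X ((s : @stdsimplex R k -> T) p).
Proof. by case=> _; apply; exists p. Qed.

Definition simplex_of k (x : 'rV[R]_k.+1) (xs : stdsimplex x) : @stdsimplex R k :=
  exist _ x (mem_set xs).

Lemma sext_in (X : set T) k (s : S k) x : @singular_in R T X k s -> stdsimplex x -> X (sext s x).
Proof. by move=> sX xs; rewrite -[x]/(val (simplex_of xs)) sextE; exact: singular_in_im sX. Qed.

Lemma sext_comp_continuous k m (s : S k) (f : @stdsimplex R m -> 'rV[R]_k.+1) :
  continuous (s : @stdsimplex R k -> T) -> continuous f -> (forall t, stdsimplex (f t)) ->
  continuous (fun t => sext s (f t)).
Proof.
move=> cs cf fs; pose g t := simplex_of (fs t).
have -> : (fun t => sext s (f t)) = (s : @stdsimplex R k -> T) \o g.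
  by apply/funext => t; rewrite /= -sextE.
by apply: continuous_comp_simplex => //; apply: into_simplex_continuous.
Qed.

End Extension.

(** * Iterated subdivision of singular chains and its homotopy to the identity *)

Section Subdivide.
Variables (C : comNzRingType) (R : realType) (n : nat).
Local Notation T := 'rV[R]_n.
Local Notation chn V := {freeg (seq V) / C}.
Local Notation S := (singular R T).
Local Notation Vm k := 'rV[R]_k.+1.
Local Notation Wm k := ('rV[R]_k.+1 * R^o)%type.

Definition at_height (V : lmodType R) (r : R) (x : V) : (V * R^o)%type := (x, r).

Definition base k : {linear chn (Vm k) -> chn (Wm k)} := smap C (at_height 0).

Definition base_sd N k : {linear chn (Vm k) -> chn (Wm k)} := base k \o sdN C _ N.

(** Any point of the simplex chosen naturally in the faces would do, since the homotopy only has to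
    remain over a convex set. In the subdivision homotopy all heights are zero. *)
Definition apex k (s : seq (Vm k)) : Wm k := at_height 0 (head 0 s).

Lemma at_height_natural r k (i : 'I_k.+2) c :
  smap C (cyl_face i) (smap C (at_height r) c) = smap C (at_height r) (smap C (coface_mx i) c).
Proof. by rewrite !smap_comp. Qed.

Lemma base_natural : model_natural base.
Proof. by move=> k i c; exact: at_height_natural. Qed.

Lemma base_sd_natural N : model_natural (base_sd N).
Proof. by move=> k i c; rewrite /base_sd /= at_height_natural sdN_natural. Qed.

Lemma base_del k c : base k (del C _ c) = del C _ (base k c).
Proof. exact: smap_del. Qed.

Lemma base_sd_del N k c : base_sd N k (del C _ c) = del C _ (base_sd N k c).
Proof. by rewrite /base_sd /= sdN_del base_del. Qed.

Lemma smap_size (V W : choiceType) (h : V ->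
  W) s : carried (fun u : seq W => size u = size s) (smap C h << s >>).
Proof. by rewrite smapU; apply: carriedU; rewrite size_map. Qed.

Lemma base_sd_size N k s : carried (fun u : seq (Wm k) => size u = size s) (base_sd N k << s >>).
Proof.
apply: (smap_carried (P := fun u => size u = size s)); last exact: sdN_size.
by move=> u <-; rewrite size_map.
Qed.

Lemma apex_natural k (i : 'I_k.+2) s : s != [::] ->
  apex (map (coface_mx i) s) = cyl_face i (apex s).
Proof. by case: s. Qed.

Definition over_simplex k (p : Wm k) := @stdsimplex R k p.1.

Definition sd_homot N k := homot (base k) (base_sd N k) (@apex k).

Lemma sd_homot_over N k s : all_in (@stdsimplex R k) s ->
  carried (all_in (@over_simplex k)) (sd_homot N k << s >>).
Proof.
move=> sD; pose A (s : seq (Vm k)) (u : seq (Wm k)) := all_in (@stdsimplex R k) s ->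
  all_in (@over_simplex k) u.
suff H : carried (A s) (sd_homot N k << s >>) by apply: carriedW H => u; apply.
apply: carried_homot => {sD}s.
- by move=> t u [_ ts] tu sD; apply: tu => x /(mem_subseq ts) /sD.
- move=> u s0 su sD x; rewrite inE => /predU1P[->|/(su sD)//].
  by case: s s0 sD {su} => // y s' _; apply; rewrite inE eqxx.
- by rewrite /base smapU; apply: carriedU => sD x /mapP[y ys ->]; exact: sD.
have [sD|nD] := pselect (all_in (@stdsimplex R k) s); last by move=> u _ /nD.
apply: (smap_carried (P := all_in (@stdsimplex R k)));
  last exact: sdN_convex (@stdsimplex_convex R k) sD.
by move=> u uD _ x /mapP[y yu ->]; exact: uD.
Qed.

Definition ext_fst k (s : S k) (p : Wm k) : T := sext s p.1.

Lemma ext_fst_face k (i : 'I_k.+2) (s : S k.+1) p :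
  ext_fst (face i s) p = ext_fst s (cyl_face i p).
Proof. exact: sext_face. Qed.

Lemma ext_fst_in (X : set T) k m (s : S k) (Q : seq (Wm k)) : @singular_in R T X k s ->
  size Q = m.+1 -> all_in (@over_simplex k) Q ->
  @singular_in R T X m (fun t => ext_fst s (aff Q (val t))).
Proof.
move=> sX Qm QD.
have QD' : all_in (@stdsimplex R k) (map fst Q) by move=> x /mapP[y /QD yD ->].
have aD t : stdsimplex (@aff R _ m (map fst Q) (val (t : @stdsimplex R m))).
  by apply: aff_convex => //; [exact: stdsimplex_convex|rewrite size_map].
have E : (fun t : @stdsimplex R m => ext_fst s (aff Q (val t)))
  = (fun t => sext s (aff (map fst Q) (val t))).
  by apply/funext => t; rewrite /ext_fst aff_pair.
rewrite E; apply: singular_inP => [|p]; last exact: sext_in.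
by apply: sext_comp_continuous => //; [exact: singular_in_cont sX|exact: aff_continuous].
Qed.

Lemma fundamental_simplex k : all_in (@stdsimplex R k) (fundamental R k).
Proof.
move=> x /mapP[i _ ->]; split=> [j|]; first by rewrite mxE; case: (_ && _).
by rewrite (bigD1 i) //= mxE !eqxx big1 ?addr0 // => j ji; rewrite mxE (negbTE ji) andbF.
Qed.

Definition sdop N k : {linear chain C S k -> chain C S k} :=
  sing_op (@ext_fst) (base_sd N) k k.

Lemma base_op k z : sing_op (@ext_fst) base k k z = z.
Proof.
apply: (@linear_ext C _ _ (sing_op (@ext_fst) base k k) idfun) => s /=.
rewrite sing_opU /base smapU realizeU; congr << _ >>; apply/funext => t.
rewrite /ext_fst aff_pair -map_comp /=.
have -> : map (fst \o at_height 0) (fundamental R k) = fundamental R k by rewrite map_id_in.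
by rewrite aff_fundamental sextE.
Qed.

Lemma sdop_bd N k z : bdl C S k (sdop N k.+1 z) = sdop N k (bdl C S k z).
Proof.
apply: sing_op_chain.
- exact: ext_fst_face.
- exact: base_sd_natural.
- exact: base_sd_del.
- exact: base_sd_size.
Qed.

Definition sdh N k : {linear chain C S k -> chain C S k.+1} :=
  sing_op (@ext_fst) (sd_homot N) k k.+1.

Lemma sdh0 N z : bdl C S 0 (sdh N 0 z) = z - sdop N 0 z.
Proof.
rewrite -{2}(base_op z); apply: sing_homotopy0.
- exact: base_del.
- exact: base_sd_del.
- by move=> k s; exact: smap_size.
- exact: base_sd_size.
- by move=> k; rewrite /base_sd /= sdN_nil.
Qed.

Lemma sdhS N k z : bdl C S k.+1 (sdh N k.+1 z) + sdh N k (bdl C S k z) = z - sdop N k.+1 z.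
Proof.
rewrite -{3}(base_op z); apply: sing_homotopyS.
- exact: ext_fst_face.
- exact: base_natural.
- exact: base_sd_natural.
- exact: base_del.
- exact: base_sd_del.
- by move=> m s; exact: smap_size.
- exact: base_sd_size.
- exact: apex_natural.
- by move=> m; rewrite /base_sd /= sdN_nil.
Qed.

Lemma sdh_in (X : set T) N k z : carried (@singular_in R T X k) z ->
  carried (@singular_in R T X k.+1) (sdh N k z).
Proof.
apply: carried_lin => s sX; rewrite /sdh sing_opU.
have H := carriedI (@sd_homot_over N k _ (@fundamental_simplex k))
  (homot_size (a := @apex k) (@smap_size _ _ (at_height 0)) (@base_sd_size N k) (s :=
    fundamental R k)).
apply: carried_lin H => u [uD us]; rewrite realizeU; apply: carriedU.
by apply: ext_fst_in => //; rewrite us size_fundamental.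
Qed.

Definition fine k (c : R) (s : S k) :=
  forall p q : @stdsimplex R k, `|(s : @stdsimplex R k -> T) p - (s : @stdsimplex R k ->
    T) q| < c.

Lemma sdop_in (X : set T) N k z : carried (@singular_in R T X k) z ->
  carried (@singular_in R T X k) (sdop N k z).
Proof.
apply: carried_lin => s sX; rewrite /sdop sing_opU.
have H := carriedI (sdN_convex (N :=
  N) (@stdsimplex_convex R k) (@fundamental_simplex k)) (@sdN_size C R _ N (fundamental R k)).
rewrite /base_sd /=; apply: (carried_lin (f := realize C (ext_fst s) k \o base k)) H => u [uD us].
rewrite /= /base smapU realizeU; apply: carriedU.
apply: ext_fst_in => //; first by rewrite size_map us size_fundamental.
by move=> x /mapP[y /uD yD ->].
Qed.

(** Claimed for all [M] beyond [N], so that a common number of subdivisions serves the finitely many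
    simplices of a chain. *)
Lemma sdop_fineU (X : set T) c k s : 0 < c -> @singular_in R T X k s ->
  exists N, forall M, (N <= M)%N -> carried (@fine k c) (sdop M k << s >>).
Proof.
move=> c0 sX.
have [d d0 dP] := simplex_unif_continuous (singular_in_cont sX) c0.
have [N NP] := sdN_small C (Vm k) (ltn0Sn k) d0 (ler0n R 2).
exists N => M NM; rewrite /sdop sing_opU /base_sd /=.
have m2 : mesh_le 2 (fundamental R k).
  move=> x y /fundamental_simplex xs /fundamental_simplex ys; apply: le_trans (ler_normB _ _) _.
  by rewrite -[2]/(1 + 1) lerD // stdsimplex_norm.
have H := carriedI (NP _ (size_fundamental R k) m2 M NM)
  (carriedI (sdN_convex (N := M) (@stdsimplex_convex R k) (@fundamental_simplex k))
    (@sdN_size C R _ M (fundamental R k))).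
apply: (carried_lin (f := realize C (ext_fst s) k \o base k)) H => u [um [uD us]].
rewrite /= /base smapU realizeU; apply: carriedU => p q.
rewrite /ext_fst !aff_pair -!map_comp (@map_id_in _ (fst \o at_height 0)) //=.
rewrite size_fundamental in us.
have uD' t : stdsimplex (@aff R _ k u (val (t : @stdsimplex R k))).
  by apply: aff_convex => //; exact: stdsimplex_convex.
rewrite -[aff u (val p)]/(val (simplex_of (uD' p))) -[aff u (val q)]/(val (simplex_of (uD' q))).
rewrite (sextE s (simplex_of (uD' p))) (sextE s (simplex_of (uD' q))); apply: dP.
rewrite /simplex_of /=.
(* Convexity of balls, used once for each of the two points, extends the mesh bound from the
   vertices to the whole affine simplex. *)
apply: (@aff_convex R k _ [set y | `|aff u (val p) - y| <= d]) => //; first exact: ball_convex.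
move=> y yu /=; rewrite distrC.
apply: (@aff_convex R k _ [set x | `|y - x| <= d]) => //; first exact: ball_convex.
by move=> x xu /=; apply: um.
Qed.

Lemma sdop_fine (X : set T) c k z : 0 < c -> carried (@singular_in R T X k) z ->
  exists N, carried (@fine k c) (sdop N k z).
Proof.
move=> c0 zX.
have [N NP] : exists N, forall s, s \in dom z -> forall M, (N <= M)%N ->
  carried (@fine k c) (sdop M k << s >>).
  have : forall s, s \in dom z -> @singular_in R T X k s by [].
  elim: (dom z) => [_|s r IH sX]; first by exists 0%N.
  have [|N NP] := IH; first by move=> s' s'r; apply: sX; rewrite inE s'r orbT.
  have [|M MP] := @sdop_fineU X c k s c0; first by apply: sX; rewrite inE eqxx.
  exists (maxn N M) => s'; rewrite inE => /predU1P[->|/NP h] m;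
    rewrite geq_max => /andP[Nm Mm]; first exact: MP.
  exact: h.
exists N; rewrite [z]freeg_decomp linear_sum; apply: carried_sum => s sz.
by rewrite linearZ; apply: carriedZ; apply: NP.
Qed.

End Subdivide.

(** * Level sets and the geometry of F_1 *)

Section SignCoherence.
Variable R : realDomainType.

Lemma normr_sum_coherent (I : finType) (a : I -> R) :
  (forall i k, 0 <= a i * a k) -> `|\sum_i a i| = \sum_i `|a i|.
Proof.
move=> aa; have [[i ai]|/forallNP an] := pselect (exists i, 0 < a i).
  have a0 k : 0 <= a k by rewrite -(pmulr_rge0 _ ai).
  by rewrite ger0_norm ?sumr_ge0 //; apply: eq_bigr => k _; rewrite ger0_norm.
have a0 k : a k <= 0 by rewrite leNgt; apply/negP; exact: an.
by rewrite ler0_norm ?sumr_le0 // -sumrN; apply: eq_bigr => k _; rewrite ler0_norm.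
Qed.

End SignCoherence.

Section SetPairs.
Variable n : nat.
Local Notation P := (setpair n).

Implicit Types v w : P.

Definition disj v : bool := [disjoint v.1 & v.2]%B.

Definition sle (v w : P) := (v.1 \subset w.1) && (v.2 \subset w.2).

Lemma sltE v w : slt v w = sle v w && (v != w).
Proof. by rewrite /slt /sle andbA. Qed.

Lemma sle_trans : transitive sle.
Proof.
move=> w v u /andP[a b] /andP[c d]; apply/andP.
by split; [exact: fintype.subset_trans a c|exact: fintype.subset_trans b d].
Qed.

Lemma sle_anti : antisymmetric sle.
Proof.
move=> [v v'] [w w'] /andP[/andP[/= a b] /andP[/= c d]].
by congr pair; apply/eqP; rewrite finset.eqEsubset ?a ?b.
Qed.

Lemma slt_trans : transitive (@slt n).
Proof.
move=> w v u; rewrite !sltE => /andP[vw vw'] /andP[wu wu'].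
rewrite (sle_trans vw wu); apply: contra_neq wu' => e; subst u.
by apply: sle_anti; rewrite wu vw.
Qed.

Lemma slt_irr (v : P) : slt v v = false. Proof. by rewrite sltE eqxx andbF. Qed.

Definition comparable v w := sle v w || sle w v.

Lemma comparableE v w : comparable v w = [|| slt v w, v == w | slt w v].
Proof.
rewrite /comparable !sltE [w == v]eq_sym.
case: eqVneq => [->|]; first by rewrite /sle !subxx.
by rewrite !andbT.
Qed.

End SetPairs.

Section Levels.
Variables (R : realType) (n : nat).
Local Notation P := (setpair n).
Local Notation T := 'rV[R]_n.

Implicit Types (v w : P) (x y : T) (th c : R).

Definition lev (x : T) (th : R) : P :=
  ([set i | th <= x 0 i]%SET, [set i | x 0 i <= - th]%SET).

(* The coordinates of [x] leave a gap of half-width [c] around the level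
   [th], at which the upper level sets are given by [v]. *)
Definition gap_at (v : P) (th c : R) (x : T) : Prop := forall i,
  [/\ i \in v.1 -> th + c <= x 0 i, i \in v.2 -> x 0 i <= - (th + c)
    & i \notin v.1 -> i \notin v.2 -> `|x 0 i| <= th - c].

(** Moving each coordinate by less than [c] cannot carry it across the threshold [th]. The
    conclusion is about [y]: the vertex chosen at [x] is a level of every nearby point. *)
Lemma gap_lev v th c x y : disj v -> 0 < th -> gap_at v th c x ->
  (forall i, `|x 0 i - y 0 i| < c) -> lev y th = v.
Proof.
move=> dv th0 g xy; case: v => v v' in dv g *.
have dj i : i \in v -> i \notin v' by move=> iv; rewrite (fintype.disjointFr dv iv).
congr pair; apply/finset.setP => i; rewrite inE; have [/= a b d] := g i; have := xy i.
all: rewrite ltr_norml => /andP[e f].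
- case: (boolP (i \in v)) => iv; first by have := a iv; lra.
  case: (boolP (i \in v')) => iv'; first by have := b iv'; lra.
  by have := d iv iv'; rewrite ler_norml => /andP[]; lra.
- case: (boolP (i \in v')) => iv'; first by have := b iv'; lra.
  case: (boolP (i \in v)) => iv; first by have := a iv; lra.
  by have := d iv iv'; rewrite ler_norml => /andP[]; lra.
Qed.

Lemma lev_le x th th' : th <= th' -> sle (lev x th') (lev x th).
Proof.
by move=> t; apply/andP; split; apply/fintype.subsetP => i; rewrite !inE; lra.
Qed.

Lemma lev_comparable x th th' : comparable (lev x th) (lev x th').
Proof.
rewrite /comparable; have [t|/ltW t] := leP th th'.
  by rewrite (lev_le x t) orbT.
by rewrite lev_le.
Qed.

Lemma vecE v i : vec R v 0 i = (i \in v.1)%:R - (i \in v.2)%:R :> R.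
Proof. by rewrite mxE. Qed.

Lemma vec1 v i : disj v -> i \in v.1 -> vec R v 0 i = 1.
Proof. by move=> dv iv; rewrite vecE iv (fintype.disjointFr dv iv) subr0. Qed.

Lemma vec2 v i : disj v -> i \in v.2 -> vec R v 0 i = -1.
Proof. by move=> dv iv; rewrite vecE iv (fintype.disjointFl dv iv) sub0r. Qed.

Lemma vec0 v i : i \notin v.1 -> i \notin v.2 -> vec R v 0 i = 0.
Proof. by move=> /negPf iv /negPf iv'; rewrite vecE iv iv' subrr. Qed.

Variant vec_spec : bool -> bool -> R -> Prop :=
 | Vec1 : vec_spec true false 1
 | Vec2 : vec_spec false true (-1)
 | Vec0 : vec_spec false false 0.

Lemma vecP v i : disj v ->
  vec_spec (i \in v.1) (i \in v.2) (vec R v 0 i).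
Proof.
move=> dv; case: (boolP (i \in v.1)) => i1.
  by rewrite (fintype.disjointFr dv i1) vec1 //; constructor.
case: (boolP (i \in v.2)) => i2; first by rewrite vec2 //; constructor.
by rewrite vec0 //; constructor.
Qed.

Lemma vec_norm_le1 v i : disj v -> `|vec R v 0 i| <= 1.
Proof. by move=> dv; case: vecP; rewrite ?normrN ?normr1 ?normr0. Qed.

Lemma lev_disjoint x th : 0 < th -> disj (lev x th).
Proof.
move=> t0; rewrite /disj fintype.disjoint_subset; apply/fintype.subsetP => i; rewrite !inE /=;
  lra.
Qed.

Lemma coherent_lev x th j : 0 < th -> 0 <= vec R (lev x th) 0 j * x 0 j.
Proof.
move=> t0; have dl := lev_disjoint x t0.
have a : (j \in (lev x th).1) = (th <= x 0 j) by rewrite inE.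
have b : (j \in (lev x th).2) = (x 0 j <= - th) by rewrite inE.
by move: a b; case: (vecP j dl) => /esym a /esym b; rewrite ?mul0r ?mulN1r ?mul1r //; lra.
Qed.

Lemma coherent_comparable v w j : disj v -> disj w ->
  comparable v w -> 0 <= vec R v 0 j * vec R w 0 j.
Proof.
move=> dv dw /orP[]/andP[/fintype.subsetP /(_ j) a /fintype.subsetP/(_ j) b].
all: by move: a b; case: (vecP j dv); case: (vecP j dw) => a b;
  rewrite ?mulr0 ?mul0r ?mulrNN ?mulr1 ?ler01 //; first [have := a isT | have := b isT].
Qed.

Lemma row_norm1 (x : T) : `|x| = 1 -> exists i, `|x 0 i| = 1.
Proof.
move=> x1; have : mx_norm x != 0 by rewrite -[mx_norm x]/`|x| x1 oner_neq0.
by move=> /mx_norm_neq0[[i j]]; rewrite -[mx_norm x]/`|x| x1 (ord1 i) => e; exists j.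
Qed.

Lemma row_norm_le (x : T) i : `|x 0 i| <= `|x|.
Proof.
rewrite [leRHS]/Num.norm /= mx_normrE.
by apply/bigmax_geP; right; exists (0, i).
Qed.

Lemma row_normE1 (x : T) i : `|x 0 i| = 1 -> (forall j, `|x 0 j| <= 1) -> `|x| = 1.
Proof.
move=> xi x1; apply/eqP; rewrite eq_le -{2}xi row_norm_le andbT.
rewrite [leLHS]/Num.norm /= mx_normrE; apply/bigmax_leP; split=> // -[a j] _ /=.
by rewrite ord1.
Qed.

End Levels.

(** * Convexity and peeling for the numerator and denominator of F_1 *)

Section Variation.
Variables (R : realType) (n : nat) (e : rel 'I_n).
Local Notation P := (setpair n).
Local Notation T := 'rV[R]_n.
Implicit Types (v w : P) (x y : T) (t th c : R).

Definition TV x : R := \sum_(i < n) \sum_(j < n | (i < j)%N && e i j) `|x 0 i - x 0 j|.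
Definition wnorm x : R := \sum_(i < n) (degree e i)%:R * `|x 0 i|.

Lemma F1E x : F1 e x = TV x / wnorm x. Proof. by []. Qed.

Definition sublevel t : set T := unit_sphere R n `&` [set x | F1 e x <= t].

Hypothesis deg_gt0 : forall i, (1 <= degree e i)%N.

Lemma wnorm_ge1 x : `|x| = 1 -> 1 <= wnorm x.
Proof.
move=> /row_norm1[i xi]; rewrite /wnorm (bigD1 i) //= xi mulr1.
apply: ler_wpDr; last by rewrite ler1n deg_gt0.
by apply: sumr_ge0 => j _; rewrite mulr_ge0.
Qed.

Lemma wnorm_gt0 x : `|x| = 1 -> 0 < wnorm x.
Proof. by move=> /wnorm_ge1; apply: lt_le_trans. Qed.

Lemma sublevelE t x : sublevel t x <-> `|x| = 1 /\ TV x <= t * wnorm x.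
Proof.
rewrite /sublevel /unit_sphere /=; split=> -[x1]; rewrite F1E ?ler_pdivrMr ?wnorm_gt0 //.
Qed.

Section Combination.
Variables (I : finType) (p : I -> R) (u : I -> T).
Hypothesis p0 : forall i, 0 <= p i.

Lemma comb_row j : (\sum_i p i *: u i) 0 j = \sum_i p i * u i 0 j.
Proof. by rewrite summxE; apply: eq_bigr => i _; rewrite mxE. Qed.

Lemma TV_convex : TV (\sum_i p i *: u i) <= \sum_i p i * TV (u i).
Proof.
rewrite /TV; under [leRHS]eq_bigr do rewrite mulr_sumr.
rewrite exchange_big /=; apply: ler_sum => a _.
under [leRHS]eq_bigr do rewrite mulr_sumr.
rewrite exchange_big /=; apply: ler_sum => b _.
rewrite !comb_row -sumrB; apply: le_trans (ler_norm_sum _ _ _) _.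
by apply: ler_sum => i _; rewrite -mulrBr normrM ger0_norm.
Qed.

Hypothesis u_coh : forall i k j, 0 <= u i 0 j * u k 0 j.

Lemma abs_comb j : `|(\sum_i p i *: u i) 0 j| = \sum_i p i * `|u i 0 j|.
Proof.
rewrite comb_row normr_sum_coherent => [|i k].
  by apply: eq_bigr => i _; rewrite normrM ger0_norm.
by rewrite mulrACA mulr_ge0 // mulr_ge0.
Qed.

Lemma wnorm_comb : wnorm (\sum_i p i *: u i) = \sum_i p i * wnorm (u i).
Proof.
rewrite /wnorm; under [RHS]eq_bigr do rewrite mulr_sumr.
rewrite exchange_big /=; apply: eq_bigr => j _.
rewrite abs_comb mulr_sumr; apply: eq_bigr => i _.
by rewrite mulrCA.
Qed.

(** [TV] is convex and [wnorm] is additive on vectors with coherent signs, so [TV - t * wnorm] stays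
    non-positive whatever the sign of [t]. The common coordinate of modulus one keeps the
    combination on the sphere. *)
Lemma sublevel_comb t : \sum_i p i = 1 -> (forall i, sublevel t (u i)) ->
  (exists j, forall i, `|u i 0 j| = 1) -> sublevel t (\sum_i p i *: u i).
Proof.
move=> p1 ut [j uj]; apply/sublevelE; split.
  apply: (@row_normE1 _ _ _ j) => [|k]; rewrite abs_comb.
    by under eq_bigr do rewrite uj mulr1.
  rewrite -p1; apply: ler_sum => i _; rewrite -[leRHS]mulr1 ler_wpM2l //.
  by have [<- _] := ut i; exact: row_norm_le.
apply: le_trans TV_convex _; rewrite wnorm_comb mulr_sumr; apply: ler_sum => i _.
by rewrite mulrCA ler_wpM2l //; have /sublevelE[] := ut i.
Qed.

End Combination.

Definition supp x : {set 'I_n} := [set i | x 0 i != 0%R]%SET.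

(* Peeling the lowest positive level [w] off [x]: both seminorms are additive
   along this decomposition. *)
Lemma peel x : x != 0 -> exists v (w : R), [/\ 0 < w, Kn_vertex v,
  [/\ forall i, (i \in v.1) = (0 < x 0 i), forall i, (i \in v.2) = (x 0 i < 0) &
      forall i, x 0 i != 0 -> w <= `|x 0 i|] &
  exists2 i, x 0 i != 0 & (x - w *: vec R v) 0 i = 0].
Proof.
move=> x0; have [i0 xi0] : exists i, x 0 i != 0.
  apply/existsP; apply: contra_neqT x0 => /existsPn H; apply/rowP => i; rewrite mxE.
  by apply/eqP; have := H i; rewrite negbK.
pose k := [arg min_(i < i0 | x 0 i != 0) `|x 0 i|]%O.
pose v : P := ([set i | (0 < x 0 i)%R]%SET, [set i | (x 0 i < 0)%R]%SET).
have [xk kmin] : x 0 k != 0 /\ forall i, x 0 i != 0 -> `|x 0 k| <= `|x 0 i|.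
  by rewrite /k; case: arg_minP.
have dv : disj v.
  rewrite /disj fintype.disjoint_subset; apply/fintype.subsetP => i; rewrite !inE -leNgt.
  exact: ltW.
exists v, `|x 0 k|; split.
- by rewrite normr_gt0.
- apply/andP; split=> //; apply/finset.set0Pn; exists k; rewrite !inE.
  by move: xk; rewrite neq_lt orbC.
- by split=> // i; rewrite inE.
- exists k => //; rewrite 2!mxE mxE.
  have a : (k \in v.1) = (0 < x 0 k) by rewrite inE.
  have b : (k \in v.2) = (x 0 k < 0) by rewrite inE.
  move: a b; case: (vecP R k dv) => /esym a /esym b.
  + by rewrite mulr1 gtr0_norm // subrr.
  + by rewrite mulrN1 ltr0_norm // opprK subrr.
  + by move: xk; rewrite neq_lt a b.
Qed.

Lemma normrD_coherent (a b : R) : 0 <= a * b -> `|a + b| = `|a| + `|b|.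
Proof.
have [a0|a0|->] := ltgtP a 0; last by rewrite add0r normr0 add0r.
- rewrite nmulr_rge0 // => b0; rewrite !ler0_norm //; [ring|exact: ltW|].
  by rewrite -[0]addr0 lerD // ltW.
- rewrite pmulr_rge0 // => b0; rewrite !ger0_norm //; first exact: ltW.
  by rewrite addr_ge0 // ltW.
Qed.

Section Peel.
Variables (x : T) (v : P) (w : R).
Hypotheses (w0 : 0 < w) (dv : disj v).
Hypothesis v1 : forall i, (i \in v.1) = (0 < x 0 i).
Hypothesis v2 : forall i, (i \in v.2) = (x 0 i < 0).
Hypothesis wx : forall i, x 0 i != 0 -> w <= `|x 0 i|.
Let x' : T := x - w *: vec R v.

Let xE i : x 0 i = w * vec R v 0 i + x' 0 i.
Proof. by rewrite !mxE; ring. Qed.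

Let spec i : [\/ vec R v 0 i = 1 /\ 0 <= x' 0 i, vec R v 0 i = -1 /\ x' 0 i <= 0
                | vec R v 0 i = 0 /\ x' 0 i = 0].
Proof.
move: (v1 i) (v2 i) (xE i) (@wx i).
case: (vecP R i dv) => /esym a /esym b c.
- rewrite gt_eqF // gtr0_norm // => /(_ isT); rewrite c => h; apply: Or31; split=> //; lra.
- rewrite lt_eqF // ltr0_norm // => /(_ isT); rewrite c => h; apply: Or32; split=> //; lra.
- by move=> _; apply: Or33; split=> //; lra.
Qed.

(** Peeling shrinks every non-zero coordinate by the same amount without crossing zero, so the
    differences of [vec R v] and of the remainder never have opposite signs. *)
Lemma TV_peel : TV x = w * TV (vec R v) + TV x'.
Proof.
rewrite /TV mulr_sumr -big_split; apply: eq_bigr => i _ /=.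
rewrite mulr_sumr -big_split; apply: eq_bigr => j _ /=.
rewrite -[in w * _](gtr0_norm w0) -normrM -normrD_coherent.
  by congr `|_|; rewrite (xE i) (xE j); ring.
case: (spec i) => -[-> a]; case: (spec j) => -[-> b]; rewrite -mulrA pmulr_rge0 //; lra.
Qed.

Lemma wnorm_peel : wnorm x = w * wnorm (vec R v) + wnorm x'.
Proof.
rewrite /wnorm mulr_sumr -big_split; apply: eq_bigr => i _ /=.
rewrite mulrCA -mulrDr -[in w * _](gtr0_norm w0) -normrM -normrD_coherent.
  by congr (_ * `|_|); rewrite xE.
case: (spec i) => -[-> a]; rewrite -mulrA pmulr_rge0 //; lra.
Qed.

Lemma peel_gap : gap_at v (w / 2) (w / 2) x.
Proof.
move=> i; have h := @wx i; split.
- rewrite v1 => xi; move: h; rewrite gt_eqF // gtr0_norm // => /(_ isT); lra.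
- rewrite v2 => xi; move: h; rewrite lt_eqF // ltr0_norm // => /(_ isT); lra.
- rewrite v1 v2 subrr -!leNgt => a b.
  have -> : x 0 i = 0 by apply/eqP; rewrite eq_le a b.
  by rewrite normr0.
Qed.

(** On the support of [x] the moduli exceed those of the remainder by exactly [w], and elsewhere
    both vectors vanish; a gap of the remainder is thus shifted by [w] and keeps its width. *)
Lemma gap_peel v' th c : 0 < th -> 0 < c ->
  gap_at v' th c x' -> gap_at v' (th + w) c x.
Proof.
move=> th0 c0 g i; have := xE i; have [] := g i.
case: (spec i) => -[->]; move: (x' 0 i) w0 => y w_gt0 a g1 g2 g3 ->; split=> h.
- have := g1 h; lra.
- have := g2 h; lra.
- move=> h'; have := g3 h h'; rewrite (ger0_norm a) ger0_norm; lra.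
- have := g1 h; lra.
- have := g2 h; lra.
- move=> h'; have := g3 h h'; rewrite (ler0_norm a) ler0_norm; lra.
- have := g1 h; lra.
- have := g2 h; lra.
- move=> h'; have := g3 h h'; rewrite a mulr0 addr0; lra.
Qed.

End Peel.

Lemma finite_pos_min (I : finType) (Q : pred I) (h : I -> R) :
  (forall i, Q i -> 0 < h i) -> exists2 m : R, 0 < m & forall i, Q i -> m <= h i.
Proof.
(* The initial value 1 takes care of an empty family. *)
move=> h0; exists (\big[Num.min/1]_(i | Q i) h i).
  by apply/bigmin_gtP; split.
by move=> i Qi; apply: bigmin_le_cond.
Qed.

Lemma vertex_norm v : Kn_vertex v -> `|vec R v| = 1.
Proof.
move=> /andP[dv /finset.set0Pn[j]]; rewrite inE => vj.
apply: (@row_normE1 _ _ _ j) => [|i]; last exact: vec_norm_le1.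
by move: vj; case: (vecP R j dv); rewrite ?normrN ?normr1.
Qed.

Lemma TV_ge0 x : 0 <= TV x.
Proof. by apply: sumr_ge0 => i _; apply: sumr_ge0. Qed.

Lemma wnorm_vec_le v : disj v -> wnorm (vec R v) <= \sum_i (degree e i)%:R.
Proof.
move=> dv; apply: ler_sum => i _; rewrite -[leRHS]mulr1 ler_wpM2l //.
exact: vec_norm_le1.
Qed.

(* If no sublevel vertex had a gap of width [c] at [x], each of the at most [n]
   terms of the peeling of [x] with non-positive [TV - t wnorm] would be small,
   and [TV x - t wnorm x] would be positive. *)
Lemma uniform_gap t : exists2 c : R, 0 < c & forall x, sublevel t x ->
  exists v th, [/\ Kn_vertex v, F1 e (vec R v) <= t, 0 < th & gap_at v th c x].
Proof.
have [m m0 mP] : exists2 m : R, 0 < m & forall v, Kn_vertex v && (t < F1 e (vec R v)) ->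
    m <= F1 e (vec R v) - t.
  by apply: finite_pos_min => v /andP[_]; rewrite subr_gt0.
pose D : R := \sum_i (degree e i)%:R.
have D0 : 0 <= D by apply: sumr_ge0.
(* A sublevel vertex is peeled off with weight below [2 * c] and has [wnorm] at most [D], so its
   term falls short of the bound by at most [K * c]. The choice of [c] makes [n] such losses smaller
   than [m]. *)
pose K : R := (m + `|t|) * D * 2.
have K0 : 0 <= K by rewrite !mulr_ge0 // addr_ge0 // ltW.
pose c : R := m / (K * n%:R + 1).
have Kn : 0 < K * n%:R + 1 by rewrite ltr_wpDl // mulr_ge0.
have c0 : 0 < c by rewrite divr_gt0.
exists c => // x0 /sublevelE[x01 x0t]; apply: contrapT => /= H.
(* Induction on the support, which loses a coordinate at each peeling; one deficit [K * c] is
   charged per peeled level. *)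
have est x : ~ (exists v th, [/\ Kn_vertex v, F1 e (vec R v) <= t, 0 < th & gap_at v th c x]) ->
    m * wnorm x - K * c * #|supp x|%:R <= TV x - t * wnorm x.
  have [N] := ubnP #|supp x|; elim: N x => // N IH x xN nx.
  have [->|/peel] := eqVneq x 0.
    have [-> ->] : TV 0 = 0 /\ wnorm 0 = 0.
      split; first by apply: big1 => i _; apply: big1 => j _; rewrite !mxE subrr normr0.
      by apply: big1 => i _; rewrite mxE normr0 mulr0.
    by rewrite !mulr0 subr0 sub0r oppr_le0 mulr_ge0 // mulr_ge0 // ltW.
  move=> [v [w [w0 Kv [v1 v2 wx] [i xi x'i]]]].
  have dv : disj v by case/andP: Kv.
  pose x' : T := x - w *: vec R v.
  have lt' : (#|supp x'| < #|supp x|)%N.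
    apply: proper_card; apply/fintype.properP; split; last first.
      by exists i; rewrite !inE ?xi // x'i eqxx.
    apply/fintype.subsetP => j; rewrite !inE; apply: contra_neq => xj.
    have -> : x' 0 j = x 0 j - w * vec R v 0 j by rewrite !mxE.
    by rewrite vec0 ?v1 ?v2 -?leNgt xj // mulr0 subr0.
  have nx' : ~ (exists v th, [/\ Kn_vertex v, F1 e (vec R v) <= t, 0 < th & gap_at v th c x']).
    move=> [v' [th [Kv' Fv' th0 g]]]; apply: nx; exists v', (th + w).
    by split=> //; [rewrite addr_gt0|apply: gap_peel g].
  have IHx := IH x' (leq_trans lt' xN) nx'; have Wx := wnorm_peel w0 dv v1 v2 wx;
    have Tx := TV_peel w0 dv v1 v2 wx.
  have v1n := vertex_norm Kv; have Wv := wnorm_gt0 v1n.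
  rewrite -/x' in Wx Tx.
  suff step : m * (w * wnorm (vec R v)) - K * c <= w * TV (vec R v) - t * (w * wnorm (vec R v)).
    have : K * c * #|supp x'|.+1%:R <= K * c * #|supp x|%:R.
      by apply: ler_wpM2l; [rewrite mulr_ge0 // ltW|rewrite ler_nat].
    rewrite -natr1 mulrDr mulr1 Wx Tx => h; lra.
  have [Fv|Fv] := leP (F1 e (vec R v)) t; last first.
    have := mP v; rewrite Kv Fv => /(_ isT); rewrite F1E lerBrDr ler_pdivlMr // => h.
    have := ler_wpM2l (ltW w0) h; have := mulr_ge0 K0 (ltW c0); lra.
  (* A heavier weight would give [x] a gap of half-width at least [c] at the sublevel vertex [v], by
     [peel_gap]. *)
  have wc : w < 2 * c.
    rewrite ltNge; apply/negP => cw; apply: nx; exists v, (w / 2); split=> //;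
      first by rewrite divr_gt0.
    move=> j; have [g1 g2 g3] := peel_gap v1 v2 wx j; split=> h.
    - have := g1 h; lra.
    - have := g2 h; lra.
    - move=> h'; have := g3 h h'; lra.
  have h1 : w * wnorm (vec R v) <= 2 * c * D.
    by apply: ler_pM; [exact: ltW|exact: ltW|exact: ltW|exact: wnorm_vec_le].
  have h2 : (m + `|t|) * (w * wnorm (vec R v)) <= (m + `|t|) * (2 * c * D).
    by apply: ler_wpM2l => //; rewrite addr_ge0 // ltW.
  have h3 : t * (w * wnorm (vec R v)) <= `|t| * (w * wnorm (vec R v)).
    by apply: ler_wpM2r; [rewrite mulr_ge0 // ltW|exact: ler_norm].
  have h4 := mulr_ge0 (ltW w0) (TV_ge0 (vec R v)).
  rewrite /K; lra.
have := est _ H; have := wnorm_ge1 x01 => W1.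
have : K * c * #|supp x0|%:R < m.
  apply: (@le_lt_trans _ _ (K * c * n%:R)).
    apply: ler_wpM2l; first by rewrite mulr_ge0 // ltW.
    by rewrite ler_nat (leq_trans (max_card _)) ?card_ord.
  rewrite /c mulrAC mulrA ltr_pdivrMr // mulrC; lra.
have : m <= m * wnorm x0 by rewrite ler_peMr // ltW.
lra.
Qed.

End Variation.

(** * Sorting chains of an order complex *)

Section OrderedChains.
Variables (C : comNzRingType) (V : choiceType) (lt : rel V).
Hypotheses (lt_tr : transitive lt) (lt_ir : irreflexive lt).
Local Notation chn := {freeg (seq V) / C}.
Implicit Types (x y v : V) (s u : seq V) (c : chn).

Definition cmp x y := [|| lt x y, x == y | lt y x].

(* Signed insertion of [x] at its sorted position, a contraction of the chains
   on the sorted sequences comparable with [x]. *)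
Fixpoint insS x s : chn :=
  if s is y :: s' then
    if x == y then 0 else if lt x y then << x :: s >> else - cone C y (insS x s')
  else << [:: x] >>.

Definition ins x : {linear chn -> chn} := flift (insS x).

Lemma insU x s : ins x << s >> = insS x s. Proof. exact: fliftU. Qed.

Lemma ins_cone x y c : ins x (cone C y c) =
  if x == y then 0 else if lt x y then cone C x (cone C y c) else - cone C y (ins x c).
Proof.
case: ifP => xy.
  apply: (@linear_ext C _ _ (ins x \o cone C y) \0) => s /=.
  by rewrite coneU insU /= xy.
case: ifP => lxy.
  apply: (@linear_ext C _ _ (ins x \o cone C y) (cone C x \o cone C y)) => s /=.
  by rewrite !coneU insU /= xy lxy.
apply: (@linear_ext C _ _ (ins x \o cone C y) (\- (cone C y \o ins x))) => s /=.
by rewrite !coneU !insU /= xy lxy.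
Qed.

Lemma insS_head x s : all (lt x) s -> insS x s = << x :: s >>.
Proof.
case: s => //= y s /andP[xy _]; rewrite xy.
by case: eqVneq xy => // ->; rewrite lt_ir.
Qed.

Lemma insS_del x s : pairwise lt s -> del C V (insS x s) + ins x (dS C s) = << s >>.
Proof.
elim: s => [_|y s IH].
  by rewrite /= delU /= !(linear0, addr0).
move=> /= /andP[ys /IH {}IH]; rewrite linearB /= insU ins_cone.
case: eqVneq => [->|xy].
  by rewrite linear0 subr0 add0r insS_head.
case: ifP => lxy.
  have xs : all (lt x) s by apply: sub_all ys => z; apply: lt_tr.
  rewrite insS_head // delU /= linearB /= coneU.
  by rewrite subrK.
rewrite linearN /= del_cone opprK -[RHS]coneU -IH.
by rewrite opprB addrA subrK [RHS]linearD.
Qed.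

(** Signed insertion sort. A repeated entry gives zero, because inserting an element already present
    does. *)
Fixpoint sortS s : chn := if s is x :: s' then ins x (sortS s') else << [::] >>.

Definition sortc : {linear chn -> chn} := flift sortS.

Lemma sortcU s : sortc << s >> = sortS s. Proof. exact: fliftU. Qed.

Lemma sortc_cone x c : sortc (cone C x c) = ins x (sortc c).
Proof.
apply: (@linear_ext C _ _ (sortc \o cone C x) (ins x \o sortc)) => s /=.
by rewrite coneU !sortcU.
Qed.

Definition sorted_in (s u : seq V) := [/\ pairwise lt u, {subset u <= s} & size u = size s].

Lemma ins_carried x s : all (cmp x) s -> pairwise lt s ->
  carried (sorted_in (x :: s)) (insS x s).
Proof.
elim: s => [|y s IH]; first by move=> _ _; apply: carriedU; split.
move=> /= /andP[xy xs] /andP[ys ss].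
case: eqVneq => [_|nxy]; first exact: carried0.
case: ifP => lxy.
  apply: carriedU; split => //=; rewrite lxy ys ss !andbT /=.
  by apply: sub_all ys => z; apply: lt_tr.
apply: carriedN; apply: carried_lin (IH xs ss) => u [su us sz]; rewrite coneU; apply: carriedU.
move: xy; rewrite /cmp lxy (negbTE nxy) /= => yx; split=> /=; last by rewrite sz.
  rewrite su andbT; apply/allP => z /us; rewrite inE => /predU1P[->//|zs].
  exact: (allP ys).
move=> z; rewrite !inE => /predU1P[->|/us]; first by rewrite eqxx orbT.
by rewrite inE => /orP[->//|->]; rewrite !orbT.
Qed.

Definition pcmp s := forall x y, x \in s -> y \in s -> cmp x y.

Lemma sortS_carried s : pcmp s -> carried (sorted_in s) (sortS s).
Proof.
elim: s => [_|x s IH cs]; first by apply: carriedU; split.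
have {}IH := IH (fun a b aS bS => cs a b (mem_behead (s := x :: s) aS) (mem_behead (s :=
  x :: s) bS)).
apply: carried_lin IH => u [su us sz]; rewrite insU.
have xu : all (cmp x) u.
  by apply/allP => y /us ys; apply: cs; rewrite !inE ?eqxx ?ys ?orbT.
apply: carriedW (ins_carried xu su) => w [sw ws zw]; split=> //; last by rewrite zw /= sz.
move=> z /ws; rewrite !inE => /orP[->//|/us->]; exact: orbT.
Qed.

Lemma ins_del x c : carried (fun s => pairwise lt s) c ->
  del C V (ins x c) + ins x (del C V c) = c.
Proof.
apply: (@linear_ext_in C _ _ _ ((del C V \o ins x) \+ (ins x \o del C V)) idfun) => s ss /=.
by rewrite insU delU insS_del.
Qed.

Lemma pcmp_face s u : is_face s u -> pcmp s -> pcmp u.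
Proof. by move=> [_ /mem_subseq us] cs x y /us xs /us ys; exact: cs. Qed.

(** By induction: the contraction identity [ins_del] turns the boundary of an insertion into the two
    terms of [dS]. Comparability guarantees that the tail has been sorted into increasing lists. *)
Lemma sortc_del c : carried pcmp c -> del C V (sortc c) = sortc (del C V c).
Proof.
apply: (@linear_ext_in C _ _ _ (del C V \o sortc) (sortc \o del C V)) => s /=.
rewrite sortcU delU; elim: s => [_|x s IH cs] /=; first by rewrite delU !linear0.
have cs' : pcmp s by move=> a b aS bS; apply: cs; rewrite inE ?aS ?bS orbT.
rewrite linearB /= sortcU sortc_cone -(IH cs').
rewrite -{2}(@ins_del x (sortS s)) ?addrK //.
by apply: carriedW (sortS_carried cs') => u [].
Qed.

Lemma sortc_id c : carried (fun s => pairwise lt s) c -> sortc c = c.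
Proof.
apply: (@linear_ext_in C _ _ _ sortc idfun) => s /=.
rewrite sortcU; elim: s => //= x s IH /andP[xs /IH ->].
by rewrite insU insS_head.
Qed.

(* The coefficient of [v]: delete [v], with the sign of its position. *)
Fixpoint extractS v s : chn :=
  if s is x :: s' then (if x == v then << s' >> else 0) - cone C x (extractS v s') else 0.

Definition extract v : {linear chn -> chn} := flift (extractS v).

Lemma extractU v s : extract v << s >> = extractS v s. Proof. exact: fliftU. Qed.

Lemma extract_cone v x c : extract v (cone C x c) = (if x == v then c else 0)
  - cone C x (extract v c).
Proof.
case: ifP => xv.
  apply: (@linear_ext C _ _ (extract v \o cone C x) (idfun \- (cone C x \o extract v))) => s /=.
  by rewrite coneU !extractU /= xv.
apply: (@linear_ext C _ _ (extract v \o cone C x) (\0 \- (cone C x \o extract v))) => s /=.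
by rewrite coneU !extractU /= xv.
Qed.

Lemma extract_del v c : extract v (del C V c) = - del C V (extract v c).
Proof.
apply: (@linear_ext C _ _ (extract v \o del C V) (\- (del C V \o extract v))) => s /=.
rewrite delU extractU; elim: s => [|x s IH] /=; first by rewrite !linear0.
rewrite !linearB /= extractU extract_cone del_cone IH.
have e (a b d : chn) : a - (b - cone C x (- d)) = - b - - (a - cone C x d).
  by rewrite (linearN (cone C x)) !opprK opprD addrCA.
by case: ifP => _; rewrite ?delU ?(linear0 (del C V)) e.
Qed.

Lemma extractS_notin v s : v \notin s -> extractS v s = 0.
Proof.
elim: s => //= x s IH; rewrite inE negb_or eq_sym => /andP[/negbTE-> /IH->].
by rewrite linear0 subr0.
Qed.

Lemma extract_carried v s : pairwise lt s -> carried (fun u =>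
  [/\ pairwise lt u, {subset u <= s}, forall y, y \in u -> lt y v || lt v y &
   (size u).+1 = size s]) (extractS v s).
Proof.
elim: s => [_|x s IH]; first exact: carried0.
move=> /= /andP[xs ss]; apply: carriedB.
  case: ifP => [/eqP xv|_]; last exact: carried0.
  apply: carriedU; split => // y ys; first by rewrite inE ys orbT.
  by rewrite -xv (allP xs y ys) orbT.
have [vs|vs] := boolP (v \in s); last by rewrite extractS_notin // linear0; exact: carried0.
apply: carried_lin (IH ss) => u [su us uv sz]; rewrite coneU; apply: carriedU; split=> /=.
- by rewrite su andbT; apply/allP => y /us; apply: (allP xs).
- by move=> y; rewrite !inE => /orP[->//|/us ->]; rewrite orbT.
- by move=> y; rewrite inE => /predU1P[->|/uv//]; rewrite (allP xs).
- by rewrite sz.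
Qed.

(** The sign picked up while [v] moves to its sorted position is the sign with which it is extracted
    from there. *)
Lemma extract_ins v c : carried (fun s => pairwise lt s /\ v \notin s) c ->
  extract v (ins v c) = c.
Proof.
apply: (@linear_ext_in C _ _ _ (extract v \o ins v) idfun) => s /= [ss].
rewrite insU; elim: s ss => [_ _|x s IH] /=.
  by rewrite extractU /= eqxx linear0 subr0.
move=> /andP[xs ss]; rewrite inE negb_or => /andP[vx vs]; rewrite (negbTE vx).
case: ifP => lvx.
  by rewrite extractU [LHS]/= eqxx eq_sym (negbTE vx)
    extractS_notin // linear0 subr0 linear0 subr0.
by rewrite linearN /= extract_cone eq_sym (negbTE vx) sub0r opprK (IH ss vs) coneU.
Qed.

End OrderedChains.

Lemma big_option (V : nmodType) m (F : option 'I_m -> V) :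
  \sum_o F o = F None + \sum_i F (Some i).
Proof.
rewrite (bigD1 None) //=; congr (_ + _).
rewrite (reindex_omap Some id) /=; first by apply: eq_bigl => i; rewrite eqxx.
by case.
Qed.

(** * Levels of a point in a simplex of K_n *)

Section Hull.
Variables (R : realType) (n : nat).
Local Notation P := (setpair n).
Local Notation T := 'rV[R]_n.
Implicit Types (v w : P) (x y : T) (s : seq P) (th : R).

Definition nonempty v := v.1 :|: v.2 != finset.set0.

(** Let [v] be the smallest vertex and [S] the total weight of the others. All others agree with [v]
    on its support, so there their sum attains its maximal modulus [S]. Hence levels up to [S] are
    those of the sum of the others, levels from [S] to [p v + S] equal [v], and higher ones are
    empty. *)
Lemma lev_sum s (p : P -> R) th : pairwise (@slt n) s -> all (@disj n) s ->
  (forall v, 0 <= p v) -> 0 < th ->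
  nonempty (lev (\sum_(v <- s) p v *: vec R v) th) ->
  lev (\sum_(v <- s) p v *: vec R v) th \in s.
Proof.
move=> + + p0 th0; elim: s => [_ _|v s IH].
  case/finset.set0Pn => i; rewrite big_nil !inE mxE; lra.
move=> /= /andP[vs ss] /andP[dv ds]; rewrite big_cons; set x' := \sum_(_ <- _) _.
set x := _ + x'; pose S := \sum_(w <- s) p w; have pv := p0 v.
have xE i : x 0 i = p v * vec R v 0 i + x' 0 i by rewrite /x !mxE.
have x'E i : x' 0 i = \sum_(w <- s) p w * vec R w 0 i.
  by rewrite /x' summxE; apply: eq_bigr => w _; rewrite mxE.
have x'1 i : i \in v.1 -> x' 0 i = S.
  move=> vi; rewrite x'E; apply: eq_big_seq => w ws; rewrite vec1 ?mulr1 ?(allP ds) //.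
  by have := allP vs w ws; rewrite sltE => /andP[/andP[/fintype.subsetP/(_ i vi)]].
have x'2 i : i \in v.2 -> x' 0 i = - S.
  move=> vi; rewrite x'E -sumrN; apply: eq_big_seq => w ws; rewrite vec2 ?mulrN1 ?(allP ds) //.
  by have := allP vs w ws; rewrite sltE => /andP[/andP[_ /fintype.subsetP/(_ i vi)]].
have x'S i : `|x' 0 i| <= S.
  rewrite x'E big_seq; apply: le_trans (ler_norm_sum _ _ _) _.
  rewrite /S [leRHS]big_seq; apply: ler_sum => w ws; rewrite normrM ger0_norm //.
  by rewrite -[leRHS]mulr1 ler_wpM2l // vec_norm_le1 ?(allP ds).
have [tS|St] := leP th S.
  have -> : lev x th = lev x' th.
    congr pair; apply/finset.setP => i; rewrite !inE xE.
      by move: (x'1 i) (x'2 i); case: (vecP R i dv) => h1 h2; rewrite ?(h1 isT) ?(h2 isT); lra.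
    by move: (x'1 i) (x'2 i); case: (vecP R i dv) => h1 h2; rewrite ?(h1 isT) ?(h2 isT); lra.
  by move=> /(IH ss ds); rewrite inE orbC => ->.
have [pS|pS] := leP th (p v + S).
  move=> _; suff -> : lev x th = v by rewrite inE eqxx.
  rewrite [RHS]surjective_pairing; congr pair; apply/finset.setP => i; rewrite !inE xE.
    by move: (x'1 i) (x'2 i) (x'S i); rewrite ler_norml; case: (vecP R i dv) => h1 h2;
      rewrite ?(h1 isT) ?(h2 isT) => /andP[]; lra.
  by move: (x'1 i) (x'2 i) (x'S i); rewrite ler_norml; case: (vecP R i dv) => h1 h2;
    rewrite ?(h1 isT) ?(h2 isT) => /andP[]; lra.
case/finset.set0Pn => i; rewrite !inE xE.
by move: (x'1 i) (x'2 i) (x'S i); rewrite ler_norml; case: (vecP R i dv) => h1 h2;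
  rewrite ?(h1 isT) ?(h2 isT) => /andP[]; lra.
Qed.

Lemma lev_aff k s (t : 'rV_k.+1) th : size s = k.+1 -> pairwise (@slt n) s -> all (@disj n) s ->
  (forall i, 0 <= t 0 i) -> 0 < th ->
  nonempty (lev (aff (map (vec R) s) t) th) -> lev (aff (map (vec R) s) t) th \in s.
Proof.
move=> sk ss ds t0 th0.
have us : uniq s.
  have := pairwise_uniq (@slt_irr n) ss; exact.
pose p v := t 0 (inord (index v s)).
have -> : aff (map (vec R) s) t = \sum_(v <- s) p v *: vec R v.
  rewrite (big_nth (finset.set0, finset.set0)) big_mkord sk; apply: eq_bigr => i _.
  by rewrite (nth_map (finset.set0, finset.set0)) ?sk // /p index_uniq ?sk // inord_val.
by apply: lev_sum => // v; exact: t0.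
Qed.

End Hull.

(** * Simplices and segments inside a closed sublevel set *)

Section Sublevels.
Variables (R : realType) (n : nat) (e : rel 'I_n).
Hypothesis deg_gt0 : forall i, (1 <= degree e i)%N.
Variable t : R.
Local Notation P := (setpair n).
Local Notation T := 'rV[R]_n.
Local Notation X := (sublevel e t).
Implicit Types (v w : P) (x y : T) (s : seq P) (th c : R).

Definition low v := Kn_vertex v /\ F1 e (vec R v) <= t.

Lemma low_vec v : low v -> X (vec R v).
Proof. by move=> [Kv Fv]; split=> //; exact: vertex_norm. Qed.

Lemma low_disj v : low v -> disj v. Proof. by case=> /andP[]. Qed.

Lemma exists_min s : s != [::] -> (forall v w, v \in s -> w \in s -> comparable v w) ->
  exists2 m, m \in s & forall v, v \in s -> sle m v.
Proof.
elim: s => // v [|w s] IH _ cs.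
  exists v; first by rewrite inE.
  by move=> w; rewrite inE => /eqP->; rewrite /sle !fintype.subxx.
have [//|a b aS bS|m ms mP] := IH; first by apply: cs; rewrite inE ?aS ?bS orbT.
have [mv|vm] := orP (cs m v (mem_behead (s := v :: _) ms) (mem_head _ _)).
  exists m; first by rewrite inE ms orbT.
  by move=> u; rewrite inE => /predU1P[->//|/mP].
exists v; first by rewrite inE eqxx.
move=> u; rewrite inE => /predU1P[->|/mP]; first by rewrite /sle !fintype.subxx.
exact: sle_trans.
Qed.

Lemma sublevel_chain (I : finType) (i0 : I) (p : I -> R) (u : I -> P) :
  (forall i, 0 <= p i) -> \sum_i p i = 1 -> (forall i, low (u i)) ->
  (forall i k, comparable (u i) (u k)) -> X (\sum_i p i *: vec R (u i)).
Proof.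
move=> p0 p1 lu cu; apply: sublevel_comb => //.
- by move=> i k j; apply: coherent_comparable => //; apply: low_disj.
- by move=> i; apply: low_vec.
(* A coordinate in the support of the smallest vertex has modulus one at all of them. *)
have [||m /mapP[i1 _ ->] mP] := @exists_min [seq u i | i <- enum I].
- by have := mem_enum I i0; case: (enum I).
- by move=> v w /mapP[i _ ->] /mapP[k _ ->].
have [/andP[_ /finset.set0Pn[j +]] _] := lu i1; rewrite inE => uj.
exists j => i; have /andP[/fintype.subsetP/(_ j) s1 /fintype.subsetP/(_ j) s2] : sle (u i1) (u i).
  by apply: mP; apply: map_f; rewrite mem_enum.
case/orP: uj => [/s1|/s2] uj; first by rewrite vec1 ?normr1 //; apply: low_disj.
by rewrite vec2 ?normrN ?normr1 //; apply: low_disj.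
Qed.

Definition level_of x v := exists2 th, 0 < th & v = lev x th.

Lemma level_comparable x v w : level_of x v -> level_of x w -> comparable v w.
Proof. by move=> [a _ ->] [b _ ->]; exact: lev_comparable. Qed.

Lemma sublevel_segment (m : nat) x (q : 'I_m -> R) (u : 'I_m -> P) (r : R) : X x ->
  (forall i, 0 <= q i) -> \sum_i q i = 1 -> 0 <= r <= 1 ->
  (forall i, low (u i)) -> (forall i, level_of x (u i)) ->
  X ((1 - r) *: x + r *: \sum_i q i *: vec R (u i)).
Proof.
move=> Xx q0 q1 /andP[r0 r1] lu xu.
(* The segment becomes a single convex combination, with [None] standing for [x]. *)
pose p (o : option 'I_m) := if o is Some i then r * q i else 1 - r.
pose z (o : option 'I_m) := if o is Some i then vec R (u i) else x.
have -> : (1 - r) *: x + r *: \sum_i q i *: vec R (u i) = \sum_o p o *: z o.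
  rewrite big_option /= scaler_sumr; congr (_ + _).
  by apply: eq_bigr => i _; rewrite scalerA.
(* This coordinate lies in every non-empty level of [x], whose threshold is at most one; it is the
   common coordinate required by [sublevel_comb]. *)
have [/row_norm1[j xj] _] := Xx.
apply: sublevel_comb => //.
- by case=> [i|] /=; rewrite ?mulr_ge0 // subr_ge0.
- case=> [i|] [k|] l /=.
  + apply: coherent_comparable; [exact: low_disj|exact: low_disj|exact: level_comparable].
  + by have [th th0 ->] := xu i; exact: coherent_lev.
  + by have [th th0 ->] := xu k; rewrite mulrC; exact: coherent_lev.
  + by rewrite -expr2 sqr_ge0.
- by rewrite big_option /= -mulr_sumr q1 mulr1 subrK.
- by case=> [i|] //=; exact: low_vec.
exists j; case=> [i|] //=; have [th th0 ui] := xu i.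
have [/andP[di /finset.set0Pn[k +]] _] := lu i; rewrite inE ui !inE => uk.
have th1 : th <= 1.
  have [<- _] := Xx; apply: le_trans (row_norm_le x k).
  by rewrite ler_normr; move: uk; rewrite (lerNr th).
have : (j \in (lev x th).1) || (j \in (lev x th).2).
  rewrite !inE; have [xj0|xj0] := leP 0 (x 0 j); apply/orP; [left|right].
    by rewrite -(ger0_norm xj0) xj.
  by move: xj; rewrite (ltr0_norm xj0); lra.
by rewrite -ui => /orP[ij|ij]; rewrite ?(vec1 R di ij) ?(vec2 R di ij) ?normrN normr1.
Qed.

Lemma choose_vertex : exists c : R, exists f : T -> P, [/\ 0 < c, forall x, X x -> low (f x)
  & forall x y, X x -> (forall i, `|x 0 i - y 0 i| < c) -> level_of y (f x)].
Proof.
have [c c0 H] := uniform_gap deg_gt0 t.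
have /choice[f fP] : forall x, exists v, X x -> low v /\ (exists2 th, 0 < th & gap_at v th c x).
  move=> x; have [Xx|nX] := pselect (X x); last by exists (finset.set0, finset.set0).
  by have [v [th [Kv Fv th0 g]]] := H x Xx; exists v => _; split=> //; exists th.
exists c, f; split=> // [x /fP[]//|x y Xx xy].
have [lf [th th0 g]] := fP x Xx; exists th => //.
by apply/esym; apply: gap_lev g _ => //; apply: low_disj.
Qed.

End Sublevels.

(** * Comparison of simplicial and singular homology *)

Lemma continuous_lerp (R : realType) (W : topologicalType) (V : normedModType R)
    (r : W -> R^o) (g h : W -> V) : continuous r -> continuous g -> continuous h ->
  continuous (fun u => (1 - r u : R) *: g u + (r u : R) *: h u).
Proof.
move=> cr cg ch u.
have c1 : {for u, continuous (fun u => 1 - r u : R^o)}.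
  exact: (continuousB (@cst_continuous W R^o 1 u) (cr u)).
exact: (continuousD (continuousZ c1 (cg u)) (continuousZ (cr u) (ch u))).
Qed.

(** * Straightening fine singular chains onto the chosen vertices *)

Section Straighten.
Variables (C : comNzRingType) (R : realType) (n : nat) (e : rel 'I_n) (t : R).
Local Notation P := (setpair n).
Local Notation T := 'rV[R]_n.
Local Notation chn V := {freeg (seq V) / C}.
Local Notation S := (singular R T).
Local Notation Vm k := 'rV[R]_k.+1.
Local Notation Wm k := ('rV[R]_k.+1 * R^o)%type.
Local Notation X := (sublevel e t).
Local Notation low := (low e t).

Hypothesis deg_gt0 : forall i, (1 <= degree e i)%N.
Variables (c : R) (f : T -> P).
Hypothesis f_low : forall x, X x -> low (f x).
Hypothesis f_level : forall x (y : T), X x -> (forall i, `|x 0 i - y 0 i| < c) ->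
  level_of y (f x).

Definition vtx k (s : S k) : seq P := [seq f (sext s q) | q <- fundamental R k].

Lemma size_vtx k (s : S k) : size (vtx s) = k.+1.
Proof. by rewrite size_map size_fundamental. Qed.

Lemma vtx_face k (i : 'I_k.+2) (s : S k.+1) : vtx (face i s) = rem_at i (vtx s).
Proof.
rewrite /vtx -[rem_at i _]/(rem_at i (map _ _)) /rem_at -map_take -map_drop -map_cat.
rewrite -[_ ++ _]/(rem_at i (fundamental R k.+1)) fundamental_face -map_comp.
by apply: eq_map => q /=; rewrite sext_face.
Qed.

Definition psi k : {linear chain C S k -> chn P} := flift (fun s : S k => << vtx s >>).

Lemma psiU k (s : S k) : psi k << s >> = << vtx s >>.
Proof. exact: fliftU. Qed.

Lemma psi_bd k z : del C P (psi k.+1 z) = psi k (bdl C S k z).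
Proof.
apply: (@linear_ext C _ _ (del C P \o psi k.+1) (psi k \o bdl C S k)) => s /=.
rewrite psiU delU dS_sum size_vtx /bdl fliftU linear_sum; apply: eq_bigr => i _.
by rewrite linearZ /= psiU vtx_face.
Qed.

Definition pts k (s : S k) : seq T := map (vec R) (vtx s).

(* Straight line from [s] to the affine simplex on the chosen vertices; on a
   fine simplex these vertices all lie in the support of every point of [s]. *)
Definition segment k (s : S k) (p : Wm k) : T :=
  (1 - p.2) *: sext s p.1 + (p.2 : R) *: aff (pts s) p.1.

Lemma segment_face k (i : 'I_k.+2) (s : S k.+1) p :
  segment (face i s) p = segment s (cyl_face i p).
Proof.
rewrite /segment sext_face /= coface_aff /pts vtx_face /rem_at.
by rewrite map_cat map_take map_drop.
Qed.

Definition top k : {linear chn (Vm k) -> chn (Wm k)} := smap C (at_height 1).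

Definition line_homot k := homot (base C R k) (top k) (@apex R k).

Definition in_cylinder k (p : Wm k) := stdsimplex p.1 /\ 0 <= (p.2 : R) <= 1.

Lemma line_homot_in k s : all_in (@stdsimplex R k) s ->
  carried (all_in (@in_cylinder k)) (line_homot k << s >>).
Proof.
move=> sD; pose A (s : seq (Vm k)) (u : seq (Wm k)) := all_in (@stdsimplex R k) s ->
  all_in (@in_cylinder k) u.
suff H : carried (A s) (line_homot k << s >>) by apply: carriedW H => u; apply.
apply: carried_homot => {sD}s.
- by move=> w u [_ ts] tu sD; apply: tu => x /(mem_subseq ts) /sD.
- move=> u s0 su sD x; rewrite inE => /predU1P[->|/(su sD)//].
  split; last by rewrite /= lexx ler01.
  by case: s s0 sD {su} => // y s' _; apply; rewrite inE eqxx.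
- rewrite /base smapU; apply: carriedU => sD x /mapP[y ys ->]; split; first exact: sD.
  by rewrite /= lexx ler01.
- rewrite /top smapU; apply: carriedU => sD x /mapP[y ys ->]; split; first exact: sD.
  by rewrite /= lexx ler01.
Qed.

Lemma at_height_size r k s : carried (fun u :
  seq (Wm k) => size u = size s) (smap C (at_height r) << s >>).
Proof. exact: smap_size. Qed.

Definition fine_in k (s : S k) := singular_in X s /\ fine c s.

Lemma fine_level k (s : S k) q p : fine_in s -> stdsimplex q -> stdsimplex p ->
  level_of (sext s p) (f (sext s q)).
Proof.
move=> [sX sf] qD pD; apply: f_level => [|i]; first exact: sext_in.
have := sf (simplex_of qD) (simplex_of pD).
rewrite -(sextE s (simplex_of qD)) -(sextE s (simplex_of pD)) /= => h.
by apply: le_lt_trans h; have := row_norm_le (sext s q - sext s p) i; rewrite !mxE.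
Qed.

Lemma vtx_level k (s : S k) v p : fine_in s -> stdsimplex p -> v \in vtx s ->
  level_of (sext s p) v.
Proof. by move=> sf pD /mapP[q /fundamental_simplex qD ->]; exact: fine_level. Qed.

Lemma vtx_low k (s : S k) v : singular_in X s -> v \in vtx s -> low v.
Proof. by move=> sX /mapP[q /fundamental_simplex qD ->]; apply: f_low; exact: sext_in. Qed.

Lemma segment_in k m (s : S k) (Q : seq (Wm k)) : fine_in s ->
  size Q = m.+1 -> all_in (@in_cylinder k) Q ->
  @singular_in R T X m (fun u => segment s (aff Q (val u))).
Proof.
move=> sf Qm QD; have [sX _] := sf.
have QD1 : all_in (@stdsimplex R k) (map fst Q) by move=> x /mapP[y /QD[yD _] ->].
have a1 u : stdsimplex (@aff R _ m (map fst Q) (val (u : @stdsimplex R m))).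
  by apply: aff_convex => //; [exact: stdsimplex_convex|rewrite size_map].
have a2 u : 0 <= (@aff R R^o m (map snd Q) (val (u : @stdsimplex R m)) : R) <= 1.
  apply: (@aff_convex R m R^o [set r : R | 0 <= r <= 1]); rewrite ?size_map //.
    move=> I p x p0 p1 xI /=; apply/andP; split.
      by apply: sumr_ge0 => i _; rewrite mulr_ge0 //; have /andP[] := xI i.
    rewrite -p1; apply: ler_sum => i _; rewrite -[leRHS]mulr1 ler_wpM2l //.
    by have /andP[] := xI i.
  by move=> r /mapP[y /QD[_ yD] ->].
have E : (fun u : @stdsimplex R m => segment s (aff Q (val u))) =
   (fun u => (1 - (aff (map snd Q) (val u) : R)) *: sext s (aff (map fst Q) (val u)) +
     (aff (map snd Q) (val u) : R) *: aff (pts s) (aff (map fst Q) (val u))).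
  by apply/funext => u; rewrite /segment aff_pair.
rewrite E {E}; apply: singular_inP => [|u].
  have cs : continuous (fun u : @stdsimplex R m => (aff (map snd Q) (val u) : R^o)).
    exact: aff_continuous.
  have cf : continuous (fun u : @stdsimplex R m => aff (map fst Q) (val u)).
    exact: aff_continuous.
  apply: continuous_lerp => //.
    by apply: sext_comp_continuous => //; exact: singular_in_cont sX.
  have -> : (fun u : @stdsimplex R m => aff (pts s) (aff (map fst Q) (val u))) =
        (fun u => aff (map (aff (pts s)) (map fst Q)) (val u)).
      by apply/funext => w; rewrite (aff_map (aff (pts s))).
  exact: aff_continuous.
have -> : aff (pts s) (aff (map fst Q) (val u)) =
    \sum_(i < k.+1) aff (map fst Q) (val u) 0 i *: vec R (nth (finset.set0, finset.set0)
      (vtx s) i).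
  by apply: eq_bigr => i _; rewrite (nth_map (finset.set0, finset.set0)) ?size_vtx.
have [q0 q1] := a1 u.
have vi (i : 'I_k.+1) : nth (finset.set0, finset.set0) (vtx s)
  i \in vtx s by rewrite mem_nth ?size_vtx.
apply: (@sublevel_segment R n e deg_gt0 t k.+1 (sext s (aff (map fst Q) (val u)))
  (fun i => aff (map fst Q) (val u) 0 i)
  (fun i => nth (finset.set0, finset.set0) (vtx s) i) _ (sext_in sX (a1 u)) q0 q1 (a2 u)) => i.
- exact: vtx_low sX (vi i).
- exact: vtx_level.
Qed.

Definition geom m : {linear chn P -> chain C S m} :=
  flift (fun s => << (fun u => aff (map (vec R) s) (val u)) : S m >>).

Lemma geomU m (s : seq P) : geom m << s >> = << (fun u => aff (map (vec R) s) (val u)) : S m >>.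
Proof. exact: fliftU. Qed.

Lemma geom_bd k w : carried (fun s : seq P => size s = k.+2) w ->
  bdl C S k (geom k.+1 w) = geom k (del C P w).
Proof.
apply: (@bd_seq C S P (fun k s u => aff (map (vec R) s) (val u))) => i s _.
apply/funext => u /=.
by rewrite coface_aff /rem_at map_cat map_take map_drop.
Qed.

Lemma segment_height r k (s : S k) (u : @stdsimplex R k) :
  segment s (aff (map (at_height r) (fundamental R k)) (val u)) =
  (1 - r) *: (s : @stdsimplex R k -> T) u + r *: aff (pts s) (val u).
Proof.
rewrite /segment aff_pair.
have -> : map fst (map (at_height r) (fundamental R k)) = fundamental R k.
  by elim: (fundamental R k) => //= x q ->.
have -> : aff (map snd (map (at_height r) (fundamental R k))) (val u) = r :> R^o.
  rewrite -[RHS]mul1r -(proj2 (stdsimplexP u)) mulr_suml; apply: eq_bigr => i _.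
  have sz : size (map (at_height r) (fundamental R k))
    = k.+1 by rewrite size_map size_fundamental.
  rewrite (nth_map (0, 0)) ?sz //.
  by rewrite [in X in X.2](nth_map 0) ?size_fundamental.
by rewrite /= aff_fundamental sextE.
Qed.

Lemma segment_base k z : sing_op (@segment) (base C R) k k z = z.
Proof.
apply: (@linear_ext C _ _ (sing_op (@segment) (base C R) k k) idfun) => s /=.
rewrite sing_opU /base smapU realizeU; congr << _ >>; apply/funext => u.
by rewrite segment_height subr0 scale1r scale0r addr0.
Qed.

Lemma segment_top k z : sing_op (@segment) top k k z = geom k (psi k z).
Proof.
apply: (@linear_ext C _ _ (sing_op (@segment) top k k) (geom k \o psi k)) => s /=.
rewrite sing_opU /top smapU realizeU psiU geomU; congr << _ >>; apply/funext => u.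
by rewrite segment_height subrr scale0r scale1r add0r.
Qed.

Definition lineh k : {linear chain C S k ->
  chain C S k.+1} := sing_op (@segment) line_homot k k.+1.

Lemma top_natural : model_natural top.
Proof. by move=> k i w; exact: at_height_natural. Qed.

Lemma top_del k w : top k (del C _ w) = del C _ (top k w).
Proof. exact: smap_del. Qed.

Lemma lineh0 z : bdl C S 0 (lineh 0 z) = z - geom 0 (psi 0 z).
Proof.
rewrite -{2}(segment_base z) -segment_top; apply: sing_homotopy0.
- exact: base_del.
- exact: top_del.
- by move=> k s; exact: at_height_size.
- by move=> k s; exact: at_height_size.
- by move=> k; rewrite /base /top !smapU.
Qed.

Lemma linehS k z : bdl C S k.+1 (lineh k.+1 z) + lineh k (bdl C S k z)
  = z - geom k.+1 (psi k.+1 z).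
Proof.
rewrite -{3}(segment_base z) -segment_top; apply: sing_homotopyS.
- exact: segment_face.
- exact: base_natural.
- exact: top_natural.
- exact: base_del.
- exact: top_del.
- by move=> m s; exact: at_height_size.
- by move=> m s; exact: at_height_size.
- exact: apex_natural.
- by move=> m; rewrite /base /top !smapU.
Qed.

Lemma lineh_in k z : carried (@fine_in k) z -> carried (@singular_in R T X k.+1) (lineh k z).
Proof.
apply: carried_lin => s sf; rewrite /lineh sing_opU.
have H := carriedI (line_homot_in (@fundamental_simplex R k))
  (homot_size (a := @apex R k) (@at_height_size 0 k) (@at_height_size 1 k) (s :=
    fundamental R k)).
apply: carried_lin H => u [uD us]; rewrite realizeU; apply: carriedU.
by apply: segment_in => //; rewrite us size_fundamental.
Qed.

(* Ordered, possibly degenerate, simplices of the induced subcomplex. *)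
Definition low_chain (s : seq P) : Prop :=
  (forall v, v \in s -> low v) /\ pcmp (@slt n) s.

Lemma psi_low_chain k z : carried (@fine_in k) z ->
  carried (fun s => low_chain s /\ size s = k.+1) (psi k z).
Proof.
apply: carried_lin => s sf; rewrite psiU; apply: carriedU; split; last exact: size_vtx.
split=> [v|v w vs ws]; first by apply: vtx_low; case: sf.
(* All chosen vertices are levels of one and the same point, here the first corner of the simplex,
   hence pairwise comparable. *)
rewrite /cmp -comparableE; have pD : stdsimplex (nth 0 (fundamental R k) 0).
  by apply: fundamental_simplex; rewrite mem_nth // size_fundamental.
exact: level_comparable (vtx_level sf pD vs) (vtx_level sf pD ws).
Qed.

Lemma aff_low_chain k s (p : @stdsimplex R k) : low_chain s -> size s = k.+1 ->
  X (aff (map (vec R) s) (val p)).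
Proof.
move=> [sl sc] sk.
have -> : aff (map (vec R) s) (val p) =
    \sum_(i < k.+1) val p 0 i *: vec R (nth (finset.set0, finset.set0) s i).
  by apply: eq_bigr => i _; rewrite (nth_map (finset.set0, finset.set0)) ?sk.
have [p0 p1] := stdsimplexP p.
have si (i : 'I_k.+1) : nth (finset.set0, finset.set0) s i \in s by rewrite mem_nth ?sk.
apply: (@sublevel_chain R n e deg_gt0 t _ ord0) => // [i|i j]; first exact: sl.
by rewrite comparableE; apply: sc.
Qed.

Lemma geom_in k w : carried (fun s => low_chain s /\ size s = k.+1) w ->
  carried (@singular_in R T X k) (geom k w).
Proof.
apply: carried_lin => s [sl sk]; rewrite geomU; apply: carriedU.
by apply: singular_inP => [|p]; [exact: aff_continuous|exact: aff_low_chain].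
Qed.

End Straighten.

Section BoundaryCycles.
Variables (C : comNzRingType) (S : semisimplicial) (Q : forall k, set (S k)).

Definition closed_chain k : set (chain C S k) :=
  match k with 0 => setT | j.+1 => [set z | bdl C S j z = 0] end.

Lemma cyclesP k (z : chain C S k) : cycles Q z <-> carried (@Q k) z /\ closed_chain z.
Proof.
case: k z => [|k] z; first by split=> [h|[]]; [split|].
by split=> -[zQ zc]; split=> //; [rewrite /closed_chain /= -bdE|rewrite /= bdE].
Qed.

Lemma boundariesP k (z : chain C S k) :
  boundaries Q z <-> exists2 w, carried (@Q k.+1) w & bdl C S k w = z.
Proof. by split=> -[w wQ]; [rewrite bdE|rewrite -bdE] => <-; exists w. Qed.

Lemma boundariesD k (z w : chain C S k) : boundaries Q z -> boundaries Q w ->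
  boundaries Q (z + w).
Proof.
move=> /boundariesP[z' zQ <-] /boundariesP[w' wQ <-]; apply/boundariesP.
by exists (z' + w'); [exact: carriedD|rewrite linearD].
Qed.

End BoundaryCycles.

(** * Simplicial homology of the induced subcomplex against singular homology *)

Section Comparison.
Variables (C : comNzRingType) (R : realType) (n : nat) (e : rel 'I_n) (t : R).
Local Notation P := (setpair n).
Local Notation T := 'rV[R]_n.
Local Notation chn V := {freeg (seq V) / C}.
Local Notation S := (singular R T).
Local Notation K := (setpair_tuples n).
Local Notation X := (sublevel e t).
Local Notation low := (low e t).
Local Notation low_chain := (low_chain e t).
Local Notation geom := (geom C R n).
Local Notation sortP := (sortc C (@slt n)).

Hypothesis deg_gt0 : forall i, (1 <= degree e i)%N.

Definition low_cell (s : seq P) := pairwise (@slt n) s /\ forall v, v \in s -> low v.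

Lemma pairwise_pcmp (s : seq P) : pairwise (@slt n) s -> pcmp (@slt n) s.
Proof.
elim: s => // x s IH /= /andP[/allP xs /IH ss] y z; rewrite !inE /cmp.
move=> /predU1P[->|ys] /predU1P[->|zs]; first by rewrite eqxx orbT.
- by rewrite xs.
- by rewrite xs ?orbT.
- exact: ss.
Qed.

Lemma low_cell_chain s : low_cell s -> low_chain s.
Proof. by move=> [ss sl]; split=> //; exact: pairwise_pcmp. Qed.

Lemma inducedP k (s : k.+1.-tuple P) :
  @induced_subcomplex R n X k s <-> low_cell s.
Proof.
split=> [[/andP[/allP sK ss] sX]|[ss sl]].
  split=> [|v vs]; first by rewrite -sorted_pairwise //; exact: slt_trans.
  by split; [exact: sK|have [] := sX v vs].
split=> [|v /sl]; last exact: low_vec.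
apply/andP; split; first by apply/allP => v /sl[].
by rewrite sorted_pairwise //; exact: slt_trans.
Qed.

Definition head_pair (s : seq P) : P := head (finset.set0, finset.set0) s.

(** A cycle of degree zero may have a non-zero augmented boundary, but that is a multiple of the
    empty list, where the homotopy vanishes. Unreduced cycles can therefore be treated uniformly in
    all degrees. *)
Lemma homot_closed (g : {linear chn P ->
  chn P}) k w : carried (fun s : seq P => size s = k.+1) w ->
  ((0 < k)%N -> del C P w = 0) -> homot idfun g head_pair (del C P w) = 0.
Proof.
case: k => [|k] wk; last by move=> ->; rewrite // linear0.
by move=> _; rewrite -(totupK wk) aug_toseq linearZ /= homot_nil scaler0.
Qed.

Lemma head_pair_in s u : s != [::] -> {subset u <= s} -> {subset head_pair s :: u <= s}.
Proof.
move=> s0 us x; rewrite inE => /predU1P[->|/us//].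
by case: s s0 {us} => // y s _; rewrite inE eqxx.
Qed.

Definition sort_homot := homot idfun sortP head_pair.

Lemma sort_homotP w : carried (pcmp (@slt n)) w ->
  del C P (sort_homot w) + sort_homot (del C P w) = w - sortP w.
Proof.
move=> wc; apply: (@homotP_in C _ _ idfun sortP head_pair (pcmp (@slt n))) => //.
- by move=> s u sc su; exact: pcmp_face su sc.
- by move=> s _; rewrite /= delU.
- move=> s sc; rewrite -delU sortc_del ?delU //; last exact: carriedU.
  exact: slt_trans.
- exact: slt_irr.
- by rewrite sortcU.
Qed.

Lemma low_chain_sub s u : low_chain s -> {subset u <= s} -> low_chain u.
Proof. by move=> [sl sc] us; split=> [v /us/sl//|v w /us vs /us ws]; exact: sc. Qed.

Lemma sort_low_cell k w : carried (fun s => low_chain s /\ size s = k.+1) w ->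
  carried (fun s => low_cell s /\ size s = k.+1) (sortP w).
Proof.
apply: carried_lin => s [[sl sc] sk]; rewrite sortcU.
apply: carriedW (sortS_carried _ sc) => [u [su us sz]|]; last exact: slt_trans.
by split; [split=> // v /us /sl|rewrite sz].
Qed.

Lemma homot_sub (Q : set (seq P)) (g : {linear chn P -> chn P}) s :
  (forall s u, Q s -> is_face s u -> Q u) ->
  (forall s : seq P, Q s ->
     carried (fun u : seq P => {subset u <= s} /\ size u = size s) (g << s >>)) ->
  Q s -> carried (fun u : seq P => {subset u <= s} /\ size u = (size s).+1)
    (homot idfun g head_pair << s >>).
Proof.
move=> Qf gs sl.
pose A i (s u : seq P) := Q s -> {subset u <= s} /\ size u = (i + size s)%N.
suff H : carried (A 1 s) (homot idfun g head_pair << s >>).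
  by apply: carriedW H => u /(_ sl).
apply: (@carried_homot2 _ _ _ _ _ _ (A 0)) => {sl}s.
- by move=> u s0 us sl; have [us' uk] := us sl; split; [exact: head_pair_in|rewrite /= uk].
- move=> v u s0 [vk vs] uv sl.
  have [uv' uk] := uv (Qf _ _ sl (conj vk vs)); split; last by rewrite /= uk -vk.
  by apply: head_pair_in => // x /uv'/(mem_subseq vs).
- by apply: carriedU => _; split.
- have [sl|nl] := pselect (Q s); last by move=> u _ /nl.
  by apply: carriedW (gs s sl) => u h _.
Qed.

Lemma sort_sub s : low_chain s ->
  carried (fun u : seq P => {subset u <= s} /\ size u = size s) (sortP << s >>).
Proof.
move=> [_ sc]; rewrite sortcU; apply: carriedW (sortS_carried _ sc) => [u []//|].
exact: slt_trans.
Qed.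

Lemma low_chain_face s u : low_chain s -> is_face s u -> low_chain u.
Proof. by move=> sl [_ /mem_subseq us]; exact: low_chain_sub us. Qed.

Lemma sort_homot_low_chain k w :
  carried (fun s => low_chain s /\ size s = k.+1) w ->
  carried (fun s => low_chain s /\ size s = k.+2) (sort_homot w).
Proof.
apply: carried_lin => s [sl sk].
apply: carriedW (homot_sub low_chain_face sort_sub sl) => u [us uk].
by split; [exact: low_chain_sub us|rewrite uk sk].
Qed.

Lemma low_cell_face s u : low_cell s -> is_face s u -> low_cell u.
Proof.
move=> [ss sl] [_ us]; split; first exact: subseq_pairwise us ss.
by move=> v /(mem_subseq us)/sl.
Qed.

Section WithVertexChoice.
Variables (c : R) (f : T -> P).
Hypothesis c0 : 0 < c.
Hypothesis f_low : forall x, X x -> low (f x).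
Hypothesis f_level : forall x (y : T), X x -> (forall i, `|x 0 i - y 0 i| < c) ->
  level_of y (f x).
Local Notation psi := (psi C f).
Local Notation sing := (@singular_in R T X).

Lemma sdop_homologous N k z : cycles sing z -> boundaries sing (z - sdop C R n N k z).
Proof.
move=> /cyclesP[zX]; case: k z zX => [|k] z zX zc; apply/boundariesP.
  by exists (sdh C R n N 0 z); [exact: sdh_in|exact: sdh0].
exists (sdh C R n N k.+1 z); first exact: sdh_in.
by rewrite -sdhS zc linear0 addr0.
Qed.

Lemma sdop_cycle N k z : cycles sing z -> cycles sing (sdop C R n N k z).
Proof.
move=> /cyclesP[zX zc]; apply/cyclesP; split; first exact: sdop_in.
by case: k z {zX} zc => // k z zc; rewrite /closed_chain /= sdop_bd zc linear0.
Qed.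

Lemma straight_homologous k z : carried (fine c (n := n) (k := k)) z -> cycles sing z ->
  boundaries sing (z - geom k (psi k z)).
Proof.
move=> zf /cyclesP[zX zc]; have zfX := carriedI zX zf; apply/boundariesP.
exists (lineh C f k z); first exact: (lineh_in deg_gt0 f_low f_level zfX).
case: k z zc {zf zX zfX} => [|k] z zc; first exact: lineh0.
by rewrite -linehS zc linear0 addr0.
Qed.

Lemma psi_closed k z : cycles sing z -> (0 < k)%N -> del C P (psi k z) = 0.
Proof. by case: k z => // k z /cyclesP[_ zc] _; rewrite psi_bd zc linear0. Qed.

(** The round trip from simplicial to singular chains and back, computed on lists: subdivide the
    affine simplex, then choose a vertex at each corner. *)
Definition approx N : {linear chn P -> chn P} := smap C f \o (sdN C T N \o smap C (vec R)).

Lemma psi_sdop_geom N k w : carried (fun s : seq P => size s = k.+1) w ->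
  psi k (sdop C R n N k (geom k w)) = approx N w.
Proof.
apply: (@linear_ext_in C _ _ _ (psi k \o (sdop C R n N k \o geom k)) (approx N)) => s sk.
rewrite /approx /= smapU geomU /sdop sing_opU /base_sd /=.
set q := map (vec R) s; set g := ext_fst _.
have qk : size q = k.+1 by rewrite size_map.
have -> : << q >> = smap C (aff q) << fundamental R k >> by rewrite smapU map_aff_fundamental.
rewrite -sdN_natural smap_comp.
have H := carriedI (sdN_convex (N :=
  N) (@stdsimplex_convex R k) (@fundamental_simplex R k)) (@sdN_size C R _ N (fundamental R k)).
apply: (@linear_ext_in C _ _ _ (psi k \o (realize C g k \o base C R k)) (smap C (f \o aff q)))
  H => u [uD us].
rewrite size_fundamental in us.
rewrite /= /base !smapU realizeU psiU; congr << _ >>.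
apply: (@eq_from_nth _ (f 0)); first by rewrite size_vtx size_map us.
move=> i; rewrite size_vtx => ik;
  rewrite [LHS](nth_map 0) ?size_fundamental // [RHS](nth_map 0) ?us //.
have -> : nth 0 (fundamental R k) i = delta_mx 0 (Ordinal ik) := nth_fundamental R (Ordinal ik).
have dD : stdsimplex (delta_mx 0 (Ordinal ik) : 'rV[R]_k.+1).
  by rewrite -nth_fundamental; apply: fundamental_simplex; rewrite mem_nth ?size_fundamental.
rewrite -[delta_mx _ _]/(val (simplex_of dD)) sextE /= aff_delta /g /ext_fst (nth_map 0) ?us //=.
have uiD : stdsimplex (nth 0 u i) by apply: uD; rewrite mem_nth ?us.
by rewrite -[nth 0 u i]/(val (simplex_of uiD)) sextE.
Qed.

Lemma approx_del N w : approx N (del C P w) = del C P (approx N w).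
Proof. by rewrite /approx /= smap_del sdN_del smap_del. Qed.

Lemma approx_nil N : approx N << [::] >> = << [::] >>.
Proof. by rewrite /approx /= smapU sdN_nil smapU. Qed.

(** The vertex chosen at a point of the simplex on [s] is one of the non-empty levels of that point,
    hence a vertex of [s] by [lev_aff]. So the round trip preserves each simplex, and the cone
    homotopy to the identity can stay inside it. *)
Lemma approx_sub N s : low_cell s ->
  carried (fun u : seq P => {subset u <= s} /\ size u = size s) (approx N << s >>).
Proof.
move=> ls; have [->|s0] := eqVneq s [::]; first by rewrite approx_nil; apply: carriedU.
have [k sk] : exists k, size s = k.+1 by case: (s) s0 => // x s' _; exists (size s').
pose q := map (vec R) s.
pose Q : set T := [set x | exists p : @stdsimplex R k, x = aff q (val p)].
have Qc : convex_closed Q.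
  move=> I p x p0 p1 /choice[y yE].
  have yD : stdsimplex (\sum_i p i *: val (y i)).
    by apply: stdsimplex_convex => // i; have := valP (y i); rewrite inE.
  exists (simplex_of yD); rewrite /= (linear_sum (aff q)); apply: eq_bigr => i _.
  by rewrite linearZ yE.
have qQ : all_in Q q.
  move=> x /(nthP 0)[i]; rewrite size_map sk => ik <-.
  have dD : stdsimplex (delta_mx 0 (Ordinal ik) : 'rV[R]_k.+1).
    by rewrite -nth_fundamental; apply: fundamental_simplex; rewrite mem_nth ?size_fundamental.
  by exists (simplex_of dD); rewrite /= aff_delta.
rewrite /approx /= smapU.
have H := carriedI (sdN_convex (C := C) (N := N) Qc qQ) (@sdN_size C R _ N q).
apply: carried_lin H => u [uQ us]; rewrite smapU; apply: carriedU; split; last first.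
  by rewrite size_map us size_map.
move=> v /mapP[x /uQ[p ->] ->].
have Xp : X (aff q (val p)) by apply: aff_low_chain => //; exact: low_cell_chain.
have [th th0 fE] : level_of (aff q (val p)) (f (aff q (val p))).
  by apply: f_level => // i; rewrite subrr normr0.
have [/andP[_ ne] _] := f_low Xp.
rewrite fE in ne *; apply: lev_aff => //.
- by case: ls.
- by apply/allP => w ws; apply: low_disj (proj2 ls w ws).
- by have [] := stdsimplexP p.
Qed.

End WithVertexChoice.

(** [z] is homologous to its subdivision, then to the affine chain on the chosen vertices, then to
    the sorted chain; the last homology is the image under [geom] of the sorting homotopy. *)
Lemma homology_surj k z : cycles (@singular_in R T X) z ->
  exists2 b, cycles (@induced_subcomplex R n X) b &
     boundaries (@singular_in R T X) (z - geom k (toseq C n k b)).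
Proof.
move=> zc; have [c [f [c0 f_low f_level]]] := choose_vertex deg_gt0 t.
have /cyclesP[zX _] := zc.
have [N zf] := sdop_fine c0 zX.
set z' := sdop C R n N k z in zf; have zc' : cycles (@singular_in R T X) z' := sdop_cycle N zc.
have /cyclesP[zX' _] := zc'.
have pl := psi_low_chain f_low f_level (carriedI zX' zf).
have sl := sort_low_cell pl.
have pcl := psi_closed f zc'.
have pp : carried (pcmp (@slt n)) (psi C f k z') by apply: carriedW pl => s [[]].
pose b := totup C n k (sortP (psi C f k z')).
have bE : toseq C n k b = sortP (psi C f k z').
  by apply: totupK; apply: carriedW sl => s [].
exists b.
  apply/cyclesP; split.
    apply: carriedW (totup_carried (Q := low_cell) sl) => s; exact: (iffRL (inducedP s)).
  case: k z {zc zX} @z' zf zc' zX' pl sl pcl pp @b bE => // k z z' zf zc' zX' pl sl pcl pp b bE.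
  rewrite /closed_chain /= /b bd_totup; last by move=> s /sl[].
  by rewrite sortc_del ?pcl ?linear0 //; [exact: slt_trans|exact: slt_irr].
rewrite bE -(subrKA z'); apply: boundariesD; first exact: sdop_homologous.
rewrite -(subrKA (geom k (psi C f k z'))); apply: boundariesD;
  first exact: (straight_homologous f_low f_level zf zc').
have ps : carried (fun s : seq P => size s = k.+1) (psi C f k z') by apply: carriedW pl => s [].
rewrite -linearB -sort_homotP // [X in _ + X](homot_closed _ ps pcl) addr0.
have wl := sort_homot_low_chain pl.
apply/boundariesP; exists (geom k.+1 (sort_homot (psi C f k z'))).
  exact: geom_in deg_gt0 _ _ wl.
by apply: geom_bd; apply: carriedW wl => s [].
Qed.

(** The vertices chosen on a fine filling bound only the round trip [approx f N] of [b]; adding the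
    homotopy [h] corrects this to [b]. Sorting then makes the filling simplicial and fixes [b],
    whose simplices are already sorted. *)
Lemma homology_inj k b : cycles (@induced_subcomplex R n X) b ->
  boundaries (@singular_in R T X) (geom k (toseq C n k b)) ->
  boundaries (@induced_subcomplex R n X) b.
Proof.
move=> /cyclesP[bX bc] /boundariesP[w wX wb].
have [c [f [c0 f_low f_level]]] := choose_vertex deg_gt0 t.
have [N wf] := sdop_fine c0 wX.
have pl := psi_low_chain f_low f_level (carriedI (sdop_in wX) wf).
set w' := sdop C R n N k.+1 w in wf pl.
set bs := toseq C n k b in wb.
have bl : carried (fun s => low_cell s /\ size s = k.+1) bs.
  apply: carriedI; last exact: toseq_size.
  by apply: toseq_carried; apply: carriedW bX => s /inducedP.
have bss : carried (fun s : seq P => size s = k.+1) bs by apply: carriedW bl => s [].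
pose h := homot idfun (approx f N) head_pair.
have hl : carried (fun s => low_chain s /\ size s = k.+2) (h bs).
  apply: carried_lin bl => s [sl sk].
  have as_ (s' : seq P) : low_cell s' ->
      carried (fun u : seq P => {subset u <= s'} /\ size u = size s') (approx f N << s' >>).
    by apply: approx_sub f_low f_level _ _.
  move=> u /(homot_sub low_cell_face as_ sl)[us uk].
  by split; [exact: low_chain_sub (low_cell_chain sl) us|rewrite uk sk].
have bcl : (0 < k)%N -> del C P bs = 0.
  by rewrite /bs; case: (k) (b) bc => // j b' bc _; rewrite -bd_toseq bc linear0.
have hE : del C P (h bs) = bs - approx f N bs.
  have := homotP head_pair (f := idfun) (fun _ => erefl) (@approx_del f N)
    (esym (approx_nil f N)) bs.
  have h0 : h (del C P bs) = 0 by exact: (@homot_closed (approx f N) k bs bss bcl).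
  by rewrite -/h h0 addr0.
have pE : del C P (psi C f k.+1 w') = approx f N bs.
  by rewrite psi_bd /w' sdop_bd wb psi_sdop_geom.
have cl v : carried (fun s => low_chain s /\ size s = k.+2) v -> carried (pcmp (@slt n)) v.
  by move=> vl s /vl[[]].
have tE : del C P (sortP (h bs + psi C f k.+1 w')) = bs.
  have cc : carried (pcmp (@slt n)) (h bs + psi C f k.+1 w').
    by apply: carriedD; [exact: cl hl|exact: cl pl].
  rewrite (sortc_del (@slt_trans n) (@slt_irr n) cc).
  rewrite linearD /= hE pE subrK (sortc_id (@slt_irr n)) //.
  by move=> s /bl[[]].
have tl := sort_low_cell (carriedD hl pl).
apply/boundariesP; exists (totup C n k.+1 (sortP (h bs + psi C f k.+1 w'))).
  apply: carriedW (totup_carried (Q := low_cell) tl) => s; exact: (iffRL (inducedP s)).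
rewrite bd_totup ?tE ?toseqK //.
by move=> s /tl[].
Qed.

End Comparison.

(** * Critical values *)

Section InclusionIso.
Variables (C : comNzRingType).

Lemma incl_homology_iso_refl (S : semisimplicial) (Q : forall k, set (S k)) k :
  incl_homology_iso C Q Q k.
Proof.
split=> [//|z zc]; exists z => //; rewrite subrr; apply/boundariesP.
by exists 0; [exact: carried0|rewrite linear0].
Qed.

Lemma boundariesW (S : semisimplicial) (Q Q' : forall k, set (S k)) k (z : chain C S k) :
  (forall k s, Q k s -> Q' k s) -> boundaries Q z -> boundaries Q' z.
Proof.
move=> QQ /boundariesP[w wQ <-]; apply/boundariesP; exists w => //.
by move=> s /wQ/QQ.
Qed.

Lemma cyclesW (S : semisimplicial) (Q Q' : forall k, set (S k)) k (z : chain C S k) :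
  (forall k s, Q k s -> Q' k s) -> cycles Q z -> cycles Q' z.
Proof.
move=> QQ /cyclesP[zQ zc]; apply/cyclesP; split=> //.
by move=> s /zQ/QQ.
Qed.

Lemma cyclesB (S : semisimplicial) (Q : forall k, set (S k)) k (z w : chain C S k) :
  cycles Q z -> cycles Q w -> cycles Q (z - w).
Proof.
move=> /cyclesP[zQ zc] /cyclesP[wQ wc]; apply/cyclesP; split; first exact: carriedB.
by case: k z w {zQ wQ} zc wc => // k z w zc wc; rewrite /closed_chain /= linearB /= zc wc subrr.
Qed.

Lemma boundariesN (S : semisimplicial) (Q : forall k, set (S k)) k (z : chain C S k) :
  boundaries Q z -> boundaries Q (- z).
Proof.
move=> /boundariesP[w wQ <-]; apply/boundariesP.
by exists (- w); [exact: carriedN|rewrite linearN].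
Qed.

Section Transfer.
Variables (S S' : semisimplicial) (P Q : forall k, set (S k)) (P' Q' : forall k, set (S' k)).
Hypotheses (PQ : forall k s, @P k s -> @Q k s) (PQ' : forall k s, @P' k s -> @Q' k s).
Variables (k : nat) (phi : {linear chain C S k -> chain C S' k}).
Hypothesis phiPc : forall b, cycles P b -> cycles P' (phi b).
Hypothesis phiQc : forall b, cycles Q b -> cycles Q' (phi b).
Hypothesis phiPb : forall b, boundaries P b -> boundaries P' (phi b).
Hypothesis phiQb : forall b, boundaries Q b -> boundaries Q' (phi b).
Hypothesis surjP : forall z, cycles P' z -> exists2 b, cycles P b & boundaries P' (z - phi b).
Hypothesis surjQ : forall z, cycles Q' z -> exists2 b, cycles Q b & boundaries Q' (z - phi b).
Hypothesis injP : forall b, cycles P b -> boundaries P' (phi b) -> boundaries P b.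
Hypothesis injQ : forall b, cycles Q b -> boundaries Q' (phi b) -> boundaries Q b.

(** A naturality square: the same [phi] induces isomorphisms for the smaller and for the larger
    families, so it commutes with the inclusions. *)
Lemma incl_homology_iso_transfer :
  incl_homology_iso C P Q k <-> incl_homology_iso C P' Q' k.
Proof.
split=> -[inj surj]; split.
- move=> z zc zQ; have [b bc zb] := surjP zc.
  rewrite -(subrK (phi b) z); apply: boundariesD => //; apply/phiPb/inj => //.
  apply: injQ; first exact: (cyclesW PQ bc).
  rewrite -(subKr z (phi b)) addrC; apply: boundariesD => //.
  by apply: boundariesN; exact: (boundariesW PQ' zb).
- move=> z zc; have [b bc zb] := surjQ zc; have [b' bc' bb] := surj b bc.
  exists (phi b'); first exact: phiPc.
  by rewrite -(subrKA (phi b)) -linearB; apply: boundariesD => //; exact: phiQb.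
- by move=> b bc bQ; apply: injP => //; apply: inj; [exact: phiPc|exact: phiQb].
- move=> b bc; have [z zc bz] := surj _ (phiQc bc); have [b' bc' zb] := surjP zc.
  exists b' => //; apply: injQ; first by apply: cyclesB => //; exact: (cyclesW PQ bc').
  by rewrite linearB -(subrKA z); apply: boundariesD => //; exact: (boundariesW PQ' zb).
Qed.

End Transfer.
End InclusionIso.

Section Critical.
Variables (C : comNzRingType) (R : realType) (n : nat) (e : rel 'I_n).
Hypothesis deg_gt0 : forall i, (1 <= degree e i)%N.
Local Notation P := (setpair n).
Local Notation T := 'rV[R]_n.
Local Notation K := (setpair_tuples n).
Local Notation X := (sublevel e).
Implicit Types (t lambda : R) (v w : P).

Definition open_sublevel lambda : set T := unit_sphere R n `&` [set x | F1 e x < lambda].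

Lemma sublevel_le t t' (x : T) : t <= t' -> X t x -> X t' x.
Proof. by move=> tt [x1 xt]; split=> //; exact: le_trans tt. Qed.

Lemma induced_homology_iso t t' k : t <= t' ->
  incl_homology_iso C (@induced_subcomplex R n (X t)) (@induced_subcomplex R n (X t')) k <->
  incl_homology_iso C (@singular_in R T (X t)) (@singular_in R T (X t')) k.
Proof.
move=> tt.
have rc r b : cycles (@induced_subcomplex R n (X r)) b ->
    cycles (@singular_in R T (X r)) (geom C R n k (toseq C n k b)).
  move=> /cyclesP[bX bc]; apply/cyclesP; split.
    apply: (@geom_in C R n e r deg_gt0 k); apply: carriedI; last exact: toseq_size.
    by apply: toseq_carried; apply: carriedW bX => s /inducedP/low_cell_chain.
  case: (k) b {bX} bc => // j b bc.
  by rewrite /closed_chain /= geom_bd -?bd_toseq ?bc ?linear0 //; exact: toseq_size.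
have rb r b : boundaries (@induced_subcomplex R n (X r)) b ->
    boundaries (@singular_in R T (X r)) (geom C R n k (toseq C n k b)).
  move=> /boundariesP[w wX <-]; apply/boundariesP; exists (geom C R n k.+1 (toseq C n k.+1 w)).
    apply: (@geom_in C R n e r deg_gt0 k.+1); apply: carriedI; last exact: toseq_size.
    by apply: toseq_carried; apply: carriedW wX => s /inducedP/low_cell_chain.
  by rewrite geom_bd ?bd_toseq //; exact: toseq_size.
apply: (@incl_homology_iso_transfer C K (singular R T)
  _ _ _ _ _ _ k (geom C R n k \o toseq C n k)).
- by move=> j s [sK sX]; split=> // v /sX; exact: sublevel_le.
- by move=> j s [sc sX]; split=> // x /sX; exact: sublevel_le.
- exact: rc.
- exact: rc.
- exact: rb.
- exact: rb.
- exact: homology_surj.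
- exact: homology_surj.
- exact: homology_inj.
- exact: homology_inj.
Qed.

Lemma eq_induced (Y Y' : set T) : (forall v, Kn_vertex v -> Y (vec R v) <-> Y' (vec R v)) ->
  @induced_subcomplex R n Y = @induced_subcomplex R n Y'.
Proof.
move=> YY; apply: functional_extensionality_dep => k; apply/seteqP.
split=> s [sK sY]; split=> // v vs; have /andP[/allP/(_ v vs) Kv _] := sK.
  by apply/(YY v Kv)/sY.
by apply/(YY v Kv)/sY.
Qed.

Lemma isolated_level lambda : exists2 eps : R, 0 < eps & forall v, Kn_vertex v ->
  lambda - eps < F1 e (vec R v) -> F1 e (vec R v) < lambda + eps -> F1 e (vec R v) = lambda.
Proof.
have [m m0 mP] : exists2 m : R, 0 < m & forall v, F1 e (vec R v) != lambda ->
    m <= `|F1 e (vec R v) - lambda|.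
  by apply: finite_pos_min => v; rewrite normr_gt0 subr_eq0.
exists m => // v _ h1 h2; apply/eqP; apply: contraT => /mP.
by rewrite ler_normr => /orP[]; lra.
Qed.

(** Near [lambda] the induced subcomplex takes only two values, the open one below [lambda] and the
    closed one from [lambda] on, so only pairs of levels on different sides matter. *)
Lemma regularP lambda : homological_regular_value C (unit_sphere R n) (F1 e) lambda <->
  forall k, incl_homology_iso C (@induced_subcomplex R n (open_sublevel lambda))
    (@induced_subcomplex R n (X lambda)) k.
Proof.
have [eps eps0 epsP] := isolated_level lambda.
have lo t : lambda - eps < t -> t < lambda ->
    @induced_subcomplex R n (X t) = @induced_subcomplex R n (open_sublevel lambda).
  move=> t1 t2; apply: eq_induced => v Kv; split=> -[vn] /= Fv; split=> //=.
    exact: le_lt_trans t2.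
  rewrite leNgt; apply/negP => tv; have := epsP v Kv (lt_trans t1 tv).
  by move=> h; move: (Fv); rewrite h ?ltxx // (lt_trans Fv) // ltrDl.
have hi t : lambda <= t -> t < lambda + eps ->
    @induced_subcomplex R n (X t) = @induced_subcomplex R n (X lambda).
  move=> t1 t2; apply: eq_induced => v Kv; split=> -[vn] /= Fv; split=> //=;
    last exact: le_trans t1.
  rewrite leNgt; apply/negP => tv; have := epsP v Kv _ (le_lt_trans Fv t2).
  by move=> h; move: (tv); rewrite h ?ltxx // (lt_trans _ tv) // ltrBlDr ltrDl.
split=> [[eps' eps'0 geom] k|iso].
  (* Close enough both to lie in the interval of regularity and to exclude vertex values from [t] up
     to [lambda]; it is paired with [lambda] itself. *)
  pose t := lambda - Num.min eps eps' / 2.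
  have m0 : 0 < Num.min eps eps' by rewrite lt_min eps0 eps'0.
  have m1 : Num.min eps eps' <= eps by rewrite ge_min lexx.
  have m2 : Num.min eps eps' <= eps' by rewrite ge_min lexx orbT.
  have tl : t < lambda by rewrite /t; lra.
  rewrite -(lo t) //; last by rewrite /t; lra.
  apply/induced_homology_iso; first exact: ltW.
  by apply: geom => //; rewrite /t; lra.
exists eps => // t1 t2 h1 h2 h3 k; apply/induced_homology_iso; first exact: ltW.
have [l1|l1] := leP lambda t1.
  rewrite (hi t1) ?(lt_trans h2) // (hi t2) //; first exact: incl_homology_iso_refl.
  exact: le_trans (ltW h2).
rewrite (lo t1) //; have [l2|l2] := leP lambda t2; first by rewrite (hi t2).
by rewrite (lo t2) ?(lt_trans h1) //; exact: incl_homology_iso_refl.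
Qed.

End Critical.

(** * The topological link of a vertex in terms of the order on pairs *)

Section Link.
Variables (R : realType) (n : nat).
Local Notation P := (setpair n).
Local Notation T := 'rV[R]_n.
Implicit Types v w : P.

Lemma Kn_simplexP k (s : k.+1.-tuple P) :
  Kn_simplex s -> pairwise (@slt n) s /\ all (@disj n) s.
Proof.
move=> /andP[Ks ss]; split; first by rewrite -sorted_pairwise //; exact: slt_trans.
by apply: sub_all Ks => v /andP[].
Qed.

Lemma weights_aff k (s : k.+1.-tuple P) (w : 'I_k.+1 -> R) :
  \sum_i w i *: vec R (tnth s i) = aff (map (vec R) s) (\row_i w i).
Proof.
apply: eq_bigr => i _; rewrite mxE (nth_map (finset.set0, finset.set0)) ?size_tuple //.
by rewrite -tnth_nth.
Qed.

Lemma gap_vec v : disj v -> gap_at v (1 / 2) (1 / 2) (vec R v).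
Proof.
move=> dv i; split=> [iv|iv|i1 i2].
- rewrite (vec1 R dv iv); lra.
- rewrite (vec2 R dv iv); lra.
- by rewrite (vec0 R i1 i2) normr0 subrr.
Qed.

(** Since [star] is a closure, a vertex in it is only known to be near points of simplices. A point
    within 1/2 of [v] has [v] as its level at height 1/2, and the non-empty levels of a point of a
    simplex are vertices of that simplex. *)
Lemma near_vertex_mem k (s : k.+1.-tuple P) v (x : T) : Kn_simplex s -> Kn_vertex v ->
  closed_simplex s x -> `|vec R v - x| < 1 / 2 -> v \in (s : seq P).
Proof.
move=> /Kn_simplexP[ss ds] /andP[dv vn] [w [w0 _ ->]]; rewrite weights_aff => vx.
have h0 : 0 < 1 / 2 :> R by rewrite divr_gt0.
set y := aff _ _ in vx.
have lE : lev y (1 / 2) = v.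
  apply: gap_lev (gap_vec dv) _ => // i; apply: le_lt_trans vx.
  by have := row_norm_le (vec R v - y) i; rewrite !mxE.
rewrite -lE; apply: lev_aff => //; first by rewrite size_tuple.
  by move=> i; rewrite mxE.
by rewrite -/y lE.
Qed.

Lemma vertex_link_comparable v w : Kn_vertex v -> Kn_vertex w -> link R v (vec R w) ->
  slt v w || slt w v.
Proof.
move=> Kv Kw [st ost]; have vw : v != w.
  (* The one-vertex simplex puts [v] into its own open star. *)
  apply/negP => /eqP e; subst w; apply: ost; exists 0%N, [tuple v]; split; rewrite ?inE //.
    by rewrite /Kn_simplex /= Kv.
  exists (fun=> 1); split=> //; first by rewrite big_ord1.
  by rewrite big_ord1 scale1r.
have [x [[k [s [sK vs sx]]] xw]] :=
  st _ (@nbhsx_ballx _ _ (vec R w) (1 / 2) (divr_gt0 ltr01 (ltr0Sn _ 1))).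
have ws : w \in (s : seq P) by apply: (near_vertex_mem sK Kw sx); move: xw; rewrite -ball_normE.
have [ss _] := Kn_simplexP sK.
have := pairwise_pcmp ss vs ws; by rewrite /cmp (negbTE vw) orFb.
Qed.

Lemma slt_coordinate v w : disj v -> disj w -> slt v w ->
  exists j, vec R v 0 j = 0 /\ `|vec R w 0 j| = 1.
Proof.
move=> dv dw /and3P[/fintype.subsetP s1 /fintype.subsetP s2 vw].
have [j +] : exists j, ((j \in w.1) && (j \notin v.1)) || ((j \in w.2) && (j \notin v.2)).
  apply/existsP; apply: contraNT vw => /existsPn H;
    rewrite [v]surjective_pairing [w]surjective_pairing.
  apply/eqP; congr pair; apply/finset.setP => i; apply/idP/idP => [|iw]; [exact: s1| |exact: s2|].
    by have := H i; rewrite iw negb_or negbK => /andP[].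
  by have := H i; rewrite iw negb_or !negbK => /andP[_].
move=> H; exists j; case/orP: H => /andP[jw jv].
  have jv2 : j \notin v.2 by apply/negP => /s2; rewrite (fintype.disjointFr dw jw).
  by rewrite vec0 // vec1 // normr1.
have jv1 : j \notin v.1 by apply/negP => /s1; rewrite (fintype.disjointFl dw jw).
by rewrite vec0 // vec2 // normrN normr1.
Qed.

Lemma comparable_link v w : Kn_vertex v -> Kn_vertex w -> slt v w || slt w v ->
  link R v (vec R w).
Proof.
move=> Kv Kw vw; split.
  apply: subset_closure; case/orP: vw => vw.
    exists 1%N, [tuple v; w]; split; [by rewrite /Kn_simplex /= Kv Kw vw|by rewrite !inE eqxx|].
    exists (fun i => (i == ord_max)%:R); split=> [i|//|]; first by rewrite ler0n.
      by rewrite !big_ord_recl big_ord0 /= addr0 add0r.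
    by rewrite !big_ord_recl big_ord0 /= scale0r add0r addr0 scale1r.
  exists 1%N, [tuple w; v]; split;
    [by rewrite /Kn_simplex /= Kv Kw vw|by rewrite !inE eqxx orbT|].
  exists (fun i => (i == ord0)%:R); split=> [i|//|]; first by rewrite ler0n.
    by rewrite !big_ord_recl big_ord0 /= !addr0.
  by rewrite !big_ord_recl big_ord0 /= scale0r !addr0 scale1r.
move=> [k [s [sK vs [a [a0 a1 wE]]]]].
have ws : w \in (s : seq P).
  apply: (near_vertex_mem sK Kw (x := vec R w)); last by rewrite subrr normr0 divr_gt0.
  by exists a; split=> // i; exact: ltW.
have [ss ds] := Kn_simplexP sK.
have /tnthP[i0 vi0] := vs.
have /allP dd := ds.
have absE j : `|vec R w 0 j| = \sum_i a i * `|vec R (tnth s i) 0 j|.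
  rewrite wE abs_comb // => [i|i l m]; first exact: ltW.
  apply: coherent_comparable; [exact/dd/mem_tnth|exact/dd/mem_tnth|].
  by rewrite comparableE; apply: pairwise_pcmp ss _ _ _ _; exact: mem_tnth.
have dv := dd _ vs; have dw := dd _ ws.
(* At a coordinate where exactly one of [v] and [w] vanishes, the positive weight of [v] is
   contradictory: it is missing from a sum that should be 1, or present in a sum that should be
   0. *)
case/orP: vw => /(slt_coordinate) => /(_ _ _)[] // j [j0 j1].
  have := absE j; rewrite j1 (bigD1 i0) //= -vi0 j0 normr0 mulr0 add0r.
  move=> h; have : \sum_(i | i != i0) a i * `|vec R (tnth s i) 0 j| <= \sum_(i | i != i0) a i.
    apply: ler_sum => i _; rewrite -[leRHS]mulr1 ler_wpM2l ?(ltW (a0 i)) // vec_norm_le1 //.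
    exact/dd/mem_tnth.
  rewrite -h -a1 (bigD1 i0) //= gerDr leNgt a0 //.
have := absE j; rewrite j0 normr0 (bigD1 i0) //= -vi0 j1 mulr1 => /eqP.
rewrite eq_sym paddr_eq0 ?(gt_eqF (a0 i0)) //; first exact: ltW.
by apply: sumr_ge0 => i _; rewrite mulr_ge0 // ltW.
Qed.

End Link.

(** * Attaching the cone over the link of an isolated vertex *)

Section IsolatedVertex.
Variables (C : comNzRingType) (R : realType) (n : nat) (e : rel 'I_n) (lambda : R).
Local Notation P := (setpair n).
Local Notation T := 'rV[R]_n.
Local Notation chn := {freeg (seq P) / C}.
Local Notation K := (setpair_tuples n).
Variable v : P.
Hypotheses (Kv : Kn_vertex v) (Fv : F1 e (vec R v) = lambda).
Hypothesis link_ne : forall w, Kn_vertex w -> link R v (vec R w) -> F1 e (vec R w) <> lambda.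

Local Notation closed_cells := (@induced_subcomplex R n (sublevel e lambda)).
Local Notation open_cells := (@induced_subcomplex R n (open_sublevel e lambda)).
Local Notation link_cells := (@induced_subcomplex R n (link R v `&` [set x | F1 e x < lambda])).
Local Notation insv := (ins C (@slt n) v).
Local Notation exv := (extract C v).

Definition link_cell (s : seq P) := pairwise (@slt n) s /\ forall w, w \in s ->
  [/\ Kn_vertex w, F1 e (vec R w) < lambda & slt v w || slt w v].

Lemma link_cellP k (s : k.+1.-tuple P) : link_cells k s <-> link_cell s.
Proof.
split=> [[sK sX]|[ss sl]].
  have [ss _] := Kn_simplexP sK; have /andP[/allP Ks _] := sK.
  by split=> // w ws; have [lw Fw] := sX w ws; split;
    [exact: Ks| |apply: vertex_link_comparable lw; last exact: Ks].
split=> [|w /sl[Kw Fw vw]]; last by split=> //; exact: comparable_link.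
apply/andP; split; first by apply/allP => w /sl[].
by rewrite sorted_pairwise //; exact: slt_trans.
Qed.

Lemma open_closed k s : open_cells k s -> closed_cells k s.
Proof. by move=> [sK sX]; split=> // w /sX[w1 Fw]; split=> //; exact: ltW. Qed.

Lemma link_open k s : link_cells k s -> open_cells k s.
Proof.
move=> [sK sX]; split=> // w ws; have [_ Fw] := sX w ws; split=> //.
by apply: vertex_norm; have /andP[/allP/(_ w ws)] := sK.
Qed.

Lemma toseq_closed k c : carried (closed_cells k) c ->
  carried (low_cell e lambda) (toseq C n k c).
Proof. by move=> h; apply: toseq_carried; apply: carriedW h => s /inducedP. Qed.

Lemma extract_open k c : carried (open_cells k) c -> exv (toseq C n k c) = 0.
Proof.
apply: (@linear_ext_in C _ _ _ (exv \o toseq C n k) \0) => s [sK sX].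
rewrite /= /toseq fliftU extractU extractS_notin //; apply/negP => /sX[_ /=].
by rewrite Fv ltxx.
Qed.

Lemma extract_link k c : carried (fun s => low_cell e lambda s /\ size s = k.+1) c ->
  carried (fun s => link_cell s /\ size s = k) (exv c).
Proof.
apply: carried_lin => s [[ss sl] sk]; rewrite extractU.
move=> u /(extract_carried ss)[su us uv uk]; split; last first.
  by apply: succn_inj; rewrite uk.
split=> // w wu; have [Kw Fw] := sl w (us w wu).
have vw : slt v w || slt w v by rewrite orbC; exact: uv.
split=> //; rewrite lt_neqAle Fw andbT; apply/eqP.
exact: (link_ne Kw (comparable_link R Kv Kw vw)).
Qed.

Lemma ins_link k c : carried (fun s => link_cell s /\ size s = k) c ->
  carried (fun s => low_cell e lambda s /\ size s = k.+1) (insv c).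
Proof.
apply: carried_lin => s [[ss sl] sk]; rewrite insU.
have vs : all (cmp (@slt n) v) s.
  by apply/allP => w /sl[_ _ /orP[h|h]]; rewrite /cmp h ?orbT.
move=> u /(ins_carried (@slt_trans n) vs ss)[su us uk]; split; last by rewrite uk /= sk.
split=> // w /us; rewrite inE => /predU1P[->|/sl[Kw Fw _]]; split=> //; first by rewrite Fv.
exact: ltW.
Qed.

Lemma link_notin s : link_cell s -> v \notin s.
Proof. by move=> [_ sl]; apply/negP => /sl[_]; rewrite Fv ltxx. Qed.

(* The [v]-component of the relation [y] fills the cycle [c] inside the link. *)
Lemma fill_in_link k (c : chn) (u : chain C K k) (y : chain C K k.+1) :
  carried (fun s => link_cell s /\ size s = k) c ->
  carried (open_cells k) u -> carried (closed_cells k.+1) y ->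
  insv c - toseq C n k u = toseq C n k (bdl C K k y) ->
  exists2 x, carried (fun s => link_cell s /\ size s = k.+1) x & del C P x = c.
Proof.
move=> cl uo yc h; exists (- exv (toseq C n k.+1 y)).
  apply: carriedN; apply: extract_link; apply: carriedI; last exact: toseq_size.
  exact: toseq_closed.
rewrite linearN -extract_del -bd_toseq -h linearB.
rewrite [X in _ - X](extract_open uo).
rewrite subr0 extract_ins //.
by move=> s /cl[sl _]; split; [case: sl|exact: link_notin].
Qed.

Lemma totup_link k c : carried (fun s => link_cell s /\ size s = k.+1) c ->
  carried (link_cells k) (totup C n k c).
Proof.
move=> cl; have h := totup_carried (Q := link_cell) cl.
by move=> s /h; exact: (iffRL (link_cellP s)).
Qed.

Lemma totup_closed k c : carried (fun s => low_cell e lambda s /\ size s = k.+1) c ->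
  carried (closed_cells k) (totup C n k c).
Proof.
move=> cl; have h := totup_carried (Q := low_cell e lambda) cl.
by move=> s /h; exact: (iffRL (inducedP e lambda s)).
Qed.

Lemma isolated_vertex_not_iso0 :
  incl_homology_iso C open_cells closed_cells 0 ->
  forall a : C, exists2 c : chain C K 0, carried (link_cells 0) c & augmentation c = a.
Proof.
(* The argument in degree -1: the cone over the empty list is the vertex [v], and filling the empty
   list inside the link yields a 0-chain of augmentation 1, which is then scaled by [a]. *)
move=> [_ surj] a.
have cl : carried (fun s => link_cell s /\ size s = 0%N) (<< [::] >> : chn).
  by apply: carriedU; split => //; split.
have il := ins_link cl.
have /surj[u /cyclesP[uo _] /boundariesP[y yc yE]] :
  cycles closed_cells (totup C n 0 (insv << [::] >>)).
  by apply/cyclesP; split=> //; exact: totup_closed.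
have [|x xl xE] := fill_in_link cl uo yc.
  by rewrite yE linearB /= totupK // => s /il[].
have xs : carried (fun s : seq P => size s = 1%N) x by move=> s /xl[].
exists (a *: totup C n 0 x); first by apply: carriedZ; exact: totup_link.
have := aug_toseq (totup C n 0 x); rewrite totupK // xE => /(congr1 (coeff [::])).
rewrite coeffZ coeffU eqxx !mulr1 => aug1.
have -> : augmentation (a *: totup C n 0 x) = a * augmentation (totup C n 0 x).
  by rewrite /augmentation !fliftE linearZ.
by rewrite -aug1 mulr1.
Qed.

Lemma isolated_vertex_not_isoS k z :
  incl_homology_iso C open_cells closed_cells k ->
  incl_homology_iso C open_cells closed_cells k.+1 ->
  reduced_cycles link_cells z -> boundaries link_cells (z : chain C K k).
Proof.
move=> [inj _] [_ surj] zr.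
(* In degree zero the vanishing augmentation is precisely the vanishing of the augmented
   boundary. *)
have [zl zc zd] : [/\ carried (link_cells k) z, closed_chain z & del C P (toseq C n k z) = 0].
  case: k z {inj surj} zr => [|k] z.
    by move=> [zl /= z0]; split=> //; rewrite aug_toseq z0 scale0r.
  by move=> /cyclesP[zl zc]; split=> //; rewrite -bd_toseq zc linear0.
have zs : carried (fun s => link_cell s /\ size s = k.+1) (toseq C n k z).
  apply: carriedI; last exact: toseq_size.
  by apply: toseq_carried => s /zl/link_cellP.
have vl := ins_link zs; set vz := insv _ in vl.
have vs : carried (fun s : seq P => size s = k.+2) vz by move=> s /vl[].
have vd : del C P vz = toseq C n k z.
  have := @ins_del C P (@slt n) (@slt_trans n) (@slt_irr n) v (toseq C n k z).
  by rewrite zd linear0 addr0; apply => s /zs[[]].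
have vb : bdl C K k (totup C n k.+1 vz) = z by rewrite bd_totup // vd toseqK.
have /boundariesP[w wo wE] : boundaries open_cells z.
  apply: inj; first by apply/cyclesP; split=> // s /zl/link_open.
  by apply/boundariesP; exists (totup C n k.+1 vz) => //; exact: totup_closed.
have /surj[u /cyclesP[uo _] /boundariesP[y yc yE]] : cycles closed_cells (totup C n k.+1 vz - w).
  apply/cyclesP; split; last by rewrite /closed_chain /= linearB /= vb wE subrr.
  by apply: carriedB; [exact: totup_closed|move=> s /wo/open_closed].
have [|x xl xE] := fill_in_link zs (carriedD wo uo) yc.
  by rewrite yE !linearB /= totupK // linearD opprD addrA.
apply/boundariesP; exists (totup C n k.+1 x); first exact: totup_link.
by rewrite bd_totup ?xE ?toseqK // => s /xl[].
Qed.

End IsolatedVertex.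

Theorem theorem1p3 (R : realType) (C : comNzRingType) (n : nat)
    (e : rel 'I_n) (e_sym : symmetric e) (e_irr : irreflexive e)
    (deg_gt0 : forall i, (1 <= degree e i)%N) (lambda : R) :
  (homological_eigenvalue e C lambda <->
   ~ (forall k : nat,
        incl_homology_iso C
          (induced_subcomplex
             (unit_sphere R n `&` [set x | F1 e x < lambda]))
          (induced_subcomplex
             (unit_sphere R n `&` [set x | F1 e x <= lambda])) k)) /\
  (forall A : {set 'I_n}, A != finset.set0 ->
     F1 e (vec R (A, finset.set0)) = lambda ->
     (forall v, Kn_vertex v -> link R (A, finset.set0) (vec R v) ->
        F1 e (vec R v) <> lambda) ->
     reduced_homology_nontrivial C
       (induced_subcomplex
          (link R (A, finset.set0) `&` [set x | F1 e x < lambda])) ->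
     homological_eigenvalue e C lambda).
Proof.
have geom := regularP C deg_gt0 lambda.
split; first by split=> h; [move/geom|move/geom].
move=> A A0 FA lA nt /geom iso.
have KA : Kn_vertex (A, finset.set0 : {set 'I_n}).
  rewrite /Kn_vertex /= finset.setU0 A0 andbT fintype.disjoint_sym.
  by rewrite fintype.disjoint_subset; apply/fintype.subsetP => i; rewrite inE.
case: nt => [[a na]|[k [z zr]]].
  have [c cl ca] := isolated_vertex_not_iso0 KA FA lA (iso 0%N) a.
  by apply: na; exists c.
have zb := isolated_vertex_not_isoS KA FA lA (iso k) (iso k.+1) zr.
by apply.
Qed.
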